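(* Let $r\geq1$ be an integer. As formal power series in $x,y,z$, $$C^{(r)}(x,y,z)=e^{(1-z)y^rx}\,A^{(r)}(x,y,z).$$
   Context: Ehrhart series: for $\mathcal{X}\subset\mathbb{R}^n$ (here a convex integral polytope with possibly some faces removed), $E(\mathcal{X},t)$ denotes the polynomial in $t$ such that $E(\mathcal{X},t)=\#(t\mathcal{X}\cap\mathbb{Z}^n)$ for every integer $t>0$; and $E^*(\mathcal{X},z):=(1-z)^{n+1}\sum_{t\geq 0}E(\mathcal{X},t)z^t$ (the value at $t=0$ is that of the polynomial). For $n\geq1$ and $1\leq k\leq rn$ let $\mathcal{A}^{(r)}_{n,k}=\{v\in[0,r)^n : k-1\leq\sum_i v_i<k\}$ and $A^{(r)}_{n,k}(z)=E^*(\mathcal{A}^{(r)}_{n,k},z)$. By convention $A^{(r)}_{n,0}(z)=\delta_{n0}$ (Kronecker delta) for all $n\ge 0$. Define $$A^{(r)}(x,y,z)=\sum_{n\geq0}\Big(\sum_{k=0}^{rn}A^{(r)}_{n,k}(z)y^k\Big)\frac{x^n}{n!}.$$ Colored permutations: $\mathfrak{S}_n^{(r)}$ is the set of pairs $(\sigma,c)$ with $\sigma\in\mathfrak{S}_n$ and $c=(c_1,\dots,c_n)\in\{0,1,\dots,r-1\}^n$. Define $\mathrm{fexc}(\sigma,c)=r\cdot\#\{i\in\{1,\dots,n\}:\sigma_i>i\text{ and }c_i=0\}+\sum_{i=1}^n c_i$; $\mathrm{des}^*(\sigma,c)=\#\{i : 1\leq i\leq n-1,\ c_i<c_{i+1}\text{,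 or }c_i=c_{i+1}\text{ and }\sigma_i>\sigma_{i+1}\}$; $\mathrm{fdes}^*(\sigma,c)=r\cdot\mathrm{des}^*(\sigma,c)+c_1$. For $n\geq1$, $1\leq k\leq rn$, let $$C^{(r)}_{n,k}(z)=\sum_{(\sigma,c)\in\mathfrak{S}^{(r)}_n,\ \mathrm{fexc}(\sigma,c)=rn-k} z^{\lceil\mathrm{fdes}^*(\sigma,c)/r\rceil},$$ and by convention $C^{(r)}_{n,0}(z)=\delta_{n0}$ for all $n\ge0$. Define $$C^{(r)}(x,y,z)=\sum_{n\geq0}\Big(\sum_{k=0}^{rn}C^{(r)}_{n,k}(z)y^k\Big)\frac{x^n}{n!}.$$ *)

(* Defs.v *)
From HB Require Import structures.
From mathcomp Require Import all_boot all_order all_fingroup all_algebra finmap.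
From mathcomp Require Import boolp classical_sets cardinality reals.

Set Implicit Arguments.
Unset Strict Implicit.
Unset Printing Implicit Defensive.

Import Order.TTheory GRing.Theory Num.Theory.
Local Open Scope ring_scope.

Record fps (R : Type) := FPS { fps_coef :> nat -> R }.

HB.instance Definition _ (R : Type) := gen_eqMixin (fps R).
HB.instance Definition _ (R : Type) := gen_choiceMixin (fps R).

Lemma fpsP (R : Type) (f g : fps R) : (forall n, f n = g n) -> f = g.
Proof. by case: f g => [f] [g] /= fg; congr FPS; apply/funext. Qed.

Section FpsRing.
Variable R : comNzRingType.
Implicit Types f g h : fps R.

Definition fpsC (c : R) : fps R := FPS (fun n => if n == 0%N then c else 0).
Definition fpsX : fps R := FPS (fun n => (n == 1%N)%:R).
Definition fps_add f g : fps R := FPS (fun n => f n + g n).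
Definition fps_opp f : fps R := FPS (fun n => - f n).
Definition fps_mul f g : fps R :=
  FPS (fun n => \sum_(i < n.+1) f i * g (n - i)%N).

Fact fps_addA : associative fps_add.
Proof. by move=> f g h; apply: fpsP => n; apply: addrA. Qed.

Fact fps_addC : commutative fps_add.
Proof. by move=> f g; apply: fpsP => n; apply: addrC. Qed.

Fact fps_add0 : left_id (fpsC 0) fps_add.
Proof. by move=> f; apply: fpsP => n /=; rewrite if_same add0r. Qed.

Fact fps_addN : left_inverse (fpsC 0) fps_opp fps_add.
Proof. by move=> f; apply: fpsP => n /=; rewrite if_same addNr. Qed.

HB.instance Definition _ :=
  GRing.isZmodule.Build (fps R) fps_addA fps_addC fps_add0 fps_addN.

Let trunc N f : {poly R} := \poly_(i < N.+1) f i.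

Let fps_mul_trunc N f g n : (n <= N)%N -> fps_mul f g n = (trunc N f * trunc N g)`_n.
Proof.
move=> nN; rewrite coefM; apply: eq_bigr => i _; rewrite !coef_poly !ltnS.
by rewrite (leq_trans _ nN) ?(leq_trans (leq_subr _ _) nN) // -ltnS.
Qed.

Fact fps_mulC : commutative fps_mul.
Proof.
by move=> f g; apply: fpsP => n; rewrite !(@fps_mul_trunc n) // mulrC.
Qed.

Fact fps_mulA : associative fps_mul.
Proof.
move=> f g h; apply: fpsP => n.
transitivity ((trunc n f * (trunc n g * trunc n h))`_n).
  rewrite coefM; apply: eq_bigr => i _; rewrite (@fps_mul_trunc n) ?leq_subr //.
  by rewrite coef_poly ltn_ord.
rewrite mulrA coefM; apply: eq_bigr => i _.
rewrite (@fps_mul_trunc n) -1?ltnS //.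
by rewrite [(trunc n h)`_ _]coef_poly ltnS leq_subr.
Qed.

Fact fps_mul1 : left_id (fpsC 1) fps_mul.
Proof.
move=> f; apply: fpsP => n /=.
by rewrite big_ord_recl /= subn0 mul1r big1 ?addr0 // => i _; rewrite mul0r.
Qed.

Fact fps_mulDl : left_distributive fps_mul fps_add.
Proof.
move=> f g h; apply: fpsP => n /=.
by rewrite -big_split /=; apply: eq_bigr => i _; rewrite mulrDl.
Qed.

Fact fps_1neq0 : fpsC 1 != 0.
Proof.
by apply/eqP => /(congr1 (fun f : fps R => f 0%N)) /eqP; rewrite /= oner_eq0.
Qed.

HB.instance Definition _ := GRing.Zmodule_isComNzRing.Build (fps R)
  fps_mulA fps_mulC fps_mul1 fps_mulDl fps_1neq0.

End FpsRing.

Arguments fpsX {R}.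

(** Q[[x, y, z]] is represented as Q[[z]][[y]][[x]]. *)

Notation fps_z := (fps rat).
Notation fps_yz := (fps fps_z).
Notation fps_xyz := (fps fps_yz).

Definition varx : fps_xyz := fpsX.
Definition vary : fps_xyz := fpsC fpsX.
Definition varz : fps_xyz := fpsC (fpsC fpsX).

Definition ratC (q : rat) : fps_yz := fpsC (fpsC q).

(** The exponential of a series [f] without constant term in [x]: [f ^+ m] then
    only involves powers of [x] that are at least [m], so the coefficient of
    [x^n] in the sum of the [f ^+ m / m!] is a finite sum. *)
Definition fps_exp (f : fps_xyz) : fps_xyz :=
  FPS (fun n => \sum_(m < n.+1) ratC (m`!%:R)^-1 * (f ^+ m : fps_xyz) n).

Definition gen_series (r : nat) (a : nat -> nat -> fps_z) : fps_xyz :=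
  FPS (fun n =>
    ratC (n`!%:R)^-1 * \sum_(k < (r * n)%N.+1) fpsC (a n k) * fpsX ^+ k).

Section Ehrhart.
Local Open Scope classical_set_scope.
Variables (R : realType) (n : nat).

(** The cardinality is meaningful for bounded [X] only: [fset_set] sends
    infinite sets to the empty one. *)
Definition lattice_count (X : set 'rV[R]_n) (t : nat) : nat :=
  #|` fset_set ([set t%:R *: v | v in X]
                `&` [set w | w \is a mxOver Num.int]) |%fset.

Definition is_ehrhart_poly (X : set 'rV[R]_n) (p : {poly rat}) : Prop :=
  forall t : nat, (0 < t)%N -> p.[t%:R] = (lattice_count X t)%:R.

(** Such a polynomial is unique; it exists for integral polytopes with some
    faces removed. The default value 0 is used when there is none. *)
Definition ehrhart_poly (X : set 'rV[R]_n) : {poly rat} :=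
  xget 0 [set p | is_ehrhart_poly X p].

Definition ehrhart_star (X : set 'rV[R]_n) : fps_z :=
  (1 - fpsX) ^+ n.+1 * FPS (fun t => (ehrhart_poly X).[t%:R]).

Definition slice (r k : nat) : set 'rV[R]_n :=
  [set v : 'rV[R]_n | (forall i, 0 <= v 0 i < r%:R)
           /\ k%:R - 1 <= \sum_(i < n) v 0 i < k%:R].

End Ehrhart.

Definition A_coef (R : realType) (r n k : nat) : fps_z :=
  if k == 0%N then (n == 0%N)%:R else ehrhart_star (@slice R n r k).

Definition A_series (R : realType) (r : nat) : fps_xyz :=
  gen_series r (A_coef R r).

(** Positions and values are shifted to {0, ..., n - 1}. *)
Definition colperm (r n : nat) : finType := ('S_n * {ffun 'I_n -> 'I_r})%type.

Section ColoredPermutations.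
Local Open Scope nat_scope.
Variables (r n : nat).
Implicit Type w : colperm r n.

Definition fexc w : nat :=
  r * #|[set i : 'I_n | (i < w.1 i) && (w.2 i == 0 :> nat)]|
  + \sum_(i < n) w.2 i.

Definition des_star w : nat :=
  #|[set i : 'I_n | [exists j : 'I_n, (j == i.+1 :> nat)
       && ((w.2 i < w.2 j) || ((w.2 i == w.2 j) && (w.1 j < w.1 i)))]]|.

(** The sum is the color of the first position (and 0 if n = 0). *)
Definition fdes_star w : nat :=
  r * des_star w + \sum_(i < n | i == 0 :> nat) w.2 i.

End ColoredPermutations.

Definition ceil_div (m d : nat) : nat := `|Num.ceil (m%:R / d%:R : rat)|%N.

Definition C_coef (r n k : nat) : fps_z :=
  if k == 0%N then (n == 0%N)%:R
  else \sum_(w : colperm r n | fexc w == (r * n - k)%N)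
         fpsX ^+ ceil_div (fdes_star w) r.

Definition C_series (r : nat) : fps_xyz := gen_series r (C_coef r).

(* Main.v *)
(** Divide both sides by [(1 - z)^(n+1)] and compare the coefficients of [z^t].

    On the left, [z^des / (1 - z)^(n+1)] counts sequences
    [t >= a_1 >= ... >= a_n >= 0] that are strict at the descents. Together with
    the colors they turn a colored permutation into a pair of a permutation [s]
    and a word in the alphabet [{0, ..., rt}], increasing lexicographically,
    weighted by the excedances of [s]. Splitting every letter in two, according
    to excedances and non-excedances, makes the weight a product over positions
    of a function of the letter of the word and the letter of the sorted word.
    The generating function (in a variable [u] marking [n]) is then given by
    MacMahon's master theorem, up to a factor correcting for fixed points, as
    the inverse of an explicit determinant:
    [(1-y) (1-u)^t / ((1-y^r u) ((1-u)^t - y (1-y^r u)^t))].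
    The master theorem itself follows from averaging over relabellings and from
    the fact that [u d/du] of [det (1 - u M)] is [- tr (u M / (1 - u M))] times
    the determinant.

    On the right, inclusion-exclusion gives the Ehrhart polynomials as
    coefficients of [(1-y) (1-y^r)^n \sum_j 'C(tj + n - 1, n) y^j], and the factor
    [e^((1-z) y^r x)] becomes the binomial transform in [n]. *)
Require Import Defs.
From HB Require Import structures.
From mathcomp Require Import all_boot all_order all_fingroup all_algebra finmap.
From mathcomp Require Import boolp classical_sets cardinality reals.
From mathcomp Require Import zify ring.

Set Implicit Arguments.
Unset Strict Implicit.
Unset Printing Implicit Defensive.

Import Order.TTheory GRing.Theory Num.Theory.
Local Open Scope ring_scope.

(** * Formal power series *)

Section FpsTheory.
Variable R : comNzRingType.
Implicit Types (f g : fps R) (c : R).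

Lemma fpsME f g n : (f * g) n = \sum_(i < n.+1) f i * g (n - i)%N.
Proof. by []. Qed.

Lemma fpsBE f g n : (f - g) n = f n - g n.
Proof. by []. Qed.

Definition fps_nth n (f : fps R) : R := f n.

Fact fps_nth_is_additive n : zmod_morphism (fps_nth n).
Proof. by []. Qed.

HB.instance Definition _ n :=
  GRing.isZmodMorphism.Build (fps R) R (fps_nth n) (fps_nth_is_additive n).

Lemma fps_sumE I (s : seq I) (P : pred I) (F : I -> fps R) n :
  (\sum_(i <- s | P i) F i) n = \sum_(i <- s | P i) F i n.
Proof. exact: (raddf_sum (fps_nth n)). Qed.

Lemma fpsMnE f m n : (f *+ m) n = f n *+ m.
Proof. exact: (raddfMn (fps_nth n)). Qed.

Lemma fps1E n : (1 : fps R) n = (n == 0%N)%:R.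
Proof. by rewrite /= -[LHS]/(if n == 0%N then 1 else 0); case: eqP. Qed.

Lemma fpsCM c f n : (fpsC c * f) n = c * f n.
Proof.
rewrite fpsME big_ord_recl /= subn0 big1 ?addr0 // => i _.
by rewrite mul0r.
Qed.

Lemma fpsC_is_additive : zmod_morphism (@fpsC R).
Proof. by move=> a b; apply: fpsP => -[|n] //=; rewrite -[RHS]/(0 - 0) subr0. Qed.

Lemma fpsC_is_multiplicative : monoid_morphism (@fpsC R).
Proof.
split=> [|a b]; first by [].
by apply: fpsP => n; rewrite fpsCM /=; case: eqP => // _; rewrite mulr0.
Qed.

HB.instance Definition _ := GRing.isZmodMorphism.Build R (fps R) (@fpsC R) fpsC_is_additive.
HB.instance Definition _ :=
  GRing.isMonoidMorphism.Build R (fps R) (@fpsC R) fpsC_is_multiplicative.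

Lemma fpsXM f n : (fpsX * f) n = if n is m.+1 then f m else 0.
Proof.
case: n => [|n]; first by rewrite fpsME big_ord1 mul0r.
rewrite fpsME !big_ord_recl /= mul0r add0r mul1r subSS subn0.
by rewrite big1 ?addr0 // => i _; rewrite mul0r.
Qed.

Lemma fpsXnM f m n : (fpsX ^+ m * f) n = if (m <= n)%N then f (n - m)%N else 0.
Proof.
elim: m n => [|m IHm] n; first by rewrite expr0 mul1r subn0.
by rewrite exprS -mulrA fpsXM; case: n => [|n] //; rewrite IHm subSS ltnS.
Qed.

Lemma fpsXnE m n : (fpsX ^+ m : fps R) n = (n == m)%:R.
Proof.
rewrite -[_ ^+ m]mulr1 fpsXnM fps1E subn_eq0.
by case: (ltngtP m n) => //= _; rewrite ?eqxx.
Qed.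

(** The derivation [u * d/du]. *)
Definition euler_op (f : fps R) : fps R := FPS (fun n => f n *+ n).

Fact euler_op_is_additive : zmod_morphism euler_op.
Proof. by move=> f g; apply: fpsP => n /=; apply: mulrnBl. Qed.

HB.instance Definition _ :=
  GRing.isZmodMorphism.Build (fps R) (fps R) euler_op euler_op_is_additive.

Lemma euler_opM f g : euler_op (f * g) = euler_op f * g + f * euler_op g.
Proof.
apply: fpsP => n; rewrite -[LHS]/((f * g) n *+ n).
rewrite -[RHS]/((euler_op f * g) n + (f * euler_op g) n).
rewrite !fpsME -sumrMnl -big_split /=.
apply: eq_bigr => i _; rewrite mulrnAl mulrnAr -mulrnDr subnKC //.
by rewrite -ltnS.
Qed.

Lemma euler_opC c : euler_op (fpsC c) = 0.
Proof. by apply: fpsP => -[|n] //=; rewrite ?mulr0n ?mul0rn. Qed.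

Lemma euler_opX : euler_op fpsX = fpsX.
Proof. by apply: fpsP => -[|[|n]] //=; rewrite mul0rn. Qed.

End FpsTheory.

(** * Derivations and determinants *)

Section Derivation.
Variables (R : comNzRingType) (d : {additive R -> R}).
Hypothesis dM : forall a b, d (a * b) = d a * b + a * d b.

Lemma derivation1 : d 1 = 0.
Proof. by have /esym := dM 1 1; rewrite !mulr1 mul1r -[RHS]addr0 => /addrI. Qed.

Lemma derivation_prod (I : eqType) (s : seq I) (F : I -> R) :
  uniq s -> d (\prod_(i <- s) F i) = \sum_(i <- s) d (F i) * \prod_(j <- s | j != i) F j.
Proof.
elim: s => [|x s IHs] /=; first by rewrite !big_nil derivation1.
case/andP=> xs us; rewrite !big_cons eqxx /= dM IHs //; congr (_ + _).
  congr (_ * _); rewrite big_seq [RHS]big_seq_cond; apply: eq_bigl => j.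
  by case: eqP => [->|_]; rewrite ?andbT //= (negPf xs).
rewrite mulr_sumr; apply: eq_big_seq => i si.
rewrite big_cons ifT 1?mulrCA //.
by apply: contraNneq xs => ->.
Qed.

Lemma derivation_sign k : d ((-1) ^+ k) = 0.
Proof.
have dN1 : d (-1) = 0 by rewrite raddfN derivation1 oppr0.
elim: k => [|k IHk]; first by rewrite derivation1.
by rewrite exprS dM dN1 IHk mul0r mulr0 addr0.
Qed.

(** Jacobi's formula: the Leibniz rule differentiates one row [i] of the permutation expansion at a
    time, and grouping the permutations by [s i] leaves the cofactors. *)
Lemma derivation_det n (A : 'M[R]_n) :
  d (\det A) = \sum_i \sum_j d (A i j) * cofactor A i j.
Proof.
rewrite /determinant raddf_sum /=.
under eq_bigr => s _.
  rewrite dM derivation_sign mul0r add0r.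
  rewrite derivation_prod ?index_enum_uniq // mulr_sumr.
  over.
rewrite exchange_big /=; apply: eq_bigr => i _.
rewrite (partition_big (fun s : 'S_n => s i) predT) //=.
apply: eq_bigr => j _; rewrite expand_cofactor big_distrr /=.
apply: eq_bigr => s /eqP <-; rewrite mulrCA; congr (_ * (_ * _)).
by apply: eq_bigl => k; rewrite eq_sym.
Qed.

End Derivation.

(** * The logarithmic derivative of det (1 - u M) *)

Section GeometricMatrix.
Variables (R : comNzRingType) (n : nat) (M : 'M[R]_n).

Definition mx_pow k : 'M[R]_n := iter k (mulmx M) 1%:M.

Definition one_sub_mx : 'M[fps R]_n := 1%:M - fpsX *: map_mx (@fpsC R) M.

Definition trace_series : fps R :=
  FPS (fun k => if k is k'.+1 then \tr (mx_pow k) else 0).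

Let resolvent : 'M[fps R]_n := \matrix_(i, j) FPS (fun k => mx_pow k i j).

Let one_sub_resolvent : one_sub_mx *m resolvent = 1%:M.
Proof.
rewrite mulmxBl mul1mx -scalemxAl; apply/matrixP => i j; rewrite !mxE.
apply: fpsP => k; rewrite -[LHS]/(_ k - _ k) fpsXM.
case: k => [|k] /=.
  by rewrite subr0 /mx_pow /= mxE; case: eqP => //.
rewrite fps_sumE !mxE [X in _ - X](eq_bigr (fun l => M i l * mx_pow k l j)) ?subrr; last first.
  by move=> l _; rewrite !mxE fpsCM.
by rewrite fpsMnE fps1E mul0rn.
Qed.

(** The resolvent, the sum of the u^k M^k, inverts [one_sub_mx], so the adjugate is the determinant
    times the resolvent; this replaces the cofactors in Jacobi's formula. *)
Lemma euler_det_one_sub :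
  euler_op (\det one_sub_mx) = - (trace_series * \det one_sub_mx).
Proof.
have adjE : \adj one_sub_mx = \det one_sub_mx *: resolvent.
  by rewrite -[LHS]mulmx1 -one_sub_resolvent mulmxA mul_adj_mx mul_scalar_mx.
rewrite (derivation_det (@euler_opM R)).
have -> : trace_series = \sum_i \sum_j (fpsX * fpsC (M i j)) * resolvent j i.
  apply: fpsP => k; rewrite fps_sumE.
  under eq_bigr => i _.
    rewrite fps_sumE.
    under eq_bigr => j _ do rewrite -mulrA fpsXM.
    over.
  case: k => [|k]; first by rewrite big1 // => i _; rewrite big1.
  rewrite -[LHS]/(\tr (mx_pow k.+1)) /mxtrace; apply: eq_bigr => i _; rewrite mxE.
  by apply: eq_bigr => j _; rewrite fpsCM !mxE.
rewrite mulr_suml -sumrN; apply: eq_bigr => i _.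
rewrite mulr_suml -sumrN; apply: eq_bigr => j _.
have -> : cofactor one_sub_mx i j = \det one_sub_mx * resolvent j i.
  by move/matrixP: adjE => /(_ j i); rewrite !mxE.
rewrite !mxE raddfB raddfMn /= euler_opM euler_opX euler_opC.
have -> : euler_op (1 : fps R) = 0 by exact: euler_opC.
by rewrite mul0rn sub0r mulr0 addr0 mulNr -!mulrA [_ * \det _]mulrC.
Qed.

End GeometricMatrix.

Lemma euler_op_eq0 (R : comNzRingType) (f : fps R) :
  (forall k (x : R), x *+ k.+1 = 0 -> x = 0) -> euler_op f = 0 -> f = fpsC (f 0%N).
Proof.
move=> tf f0; apply: fpsP => -[|n] //=; apply: (tf n).
by rewrite -[LHS]/(fps_nth n.+1 (euler_op f)) f0 raddf0.
Qed.

(** * MacMahon's master theorem *)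

Section LabelledSums.
Variables (R : comNzRingType) (N : nat).
Implicit Types (M B : 'M[R]_N).

(** Arcs of a permutation with labelled points carry matrix entries: summing over the labels turns a
    cycle of length k into the trace of M^k. *)
Definition labelled_sum M n : R :=
  \sum_(s : 'S_n) \sum_(l : {ffun 'I_n -> 'I_N}) \prod_i M (l i) (l (s i)).

(** The arc leaving [m] carries [B], which will be a power of [M] recording the points already
    contracted into that arc. *)
Definition marked_sum M B n (m : 'I_n) : R :=
  \sum_(s : 'S_n) \sum_(l : {ffun 'I_n -> 'I_N})
    \prod_i (if i == m then B else M) (l i) (l (s i)).

Lemma marked_sum_id M n (m : 'I_n) : marked_sum M M m = labelled_sum M n.
Proof.
apply: eq_bigr => s _; apply: eq_bigr => l _; apply: eq_bigr => i _.
by rewrite if_same.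
Qed.

Lemma ffun_cons_bij n (m : 'I_n.+1) (T : finType) :
  bijective (fun p : T * {ffun 'I_n -> T} =>
               [ffun i => if unlift m i is Some k then p.2 k else p.1]).
Proof.
apply: inj_card_bij.
  move=> [a l] [b k] /= /ffunP E; congr (_, _).
    by have := E m; rewrite !ffunE unlift_none.
  by apply/ffunP => i; have := E (lift m i); rewrite !ffunE liftK.
by rewrite card_prod !card_ffun !card_ord expnS.
Qed.

(** The point [m] is added as a fixed point, then inserted in a cycle so that its image is [p.1]. *)
Lemma perm_cons_bij n (m : 'I_n.+1) :
  bijective (fun p : 'I_n.+1 * 'S_n => (lift_perm m m p.2 * tperm m p.1)%g).
Proof.
apply: inj_card_bij.
  move=> [j s] [k t] /= /permP E.
  have jk : j = k by have := E m; rewrite !permM !lift_perm_id !tpermL.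
  congr (_, _) => //; apply/permP => i; rewrite jk in E.
  have := E (lift m i); rewrite !permM !lift_perm_lift => /perm_inj.
  exact: lift_inj.
by rewrite card_prod card_ord !card_Sn factS.
Qed.

(** Removing the point [m] from its cycle replaces the two arcs at [m] by a
    single one, and summing over the label of [m] multiplies the matrices. *)
Lemma marked_sum_contract M B n (m : 'I_n.+1) :
  marked_sum M B m = \tr B * labelled_sum M n + \sum_(k < n) marked_sum M (M *m B) k.
Proof.
pose W (l : {ffun 'I_n.+1 -> 'I_N}) (s : 'S_n.+1) :=
  \prod_i (if i == m then B else M) (l i) (l (s i)).
pose cons_l a (l : {ffun 'I_n -> 'I_N}) :=
  [ffun i => if unlift m i is Some k then l k else a].
have cons_m a l : cons_l a l m = a by rewrite ffunE unlift_none.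
have cons_lift a l k : cons_l a l (lift m k) = l k by rewrite ffunE liftK.
have WE a l j s : W (cons_l a l) (lift_perm m m s * tperm m j)%g =
    B a (cons_l a l j) *
    \prod_k M (l k) (cons_l a l (tperm m j (lift m (s k)))).
  rewrite /W (bigD1_ord m) //= eqxx cons_m permM lift_perm_id tpermL.
  congr (_ * _); apply: eq_bigr => k _.
  by rewrite eq_sym (negPf (neq_lift _ _)) cons_lift permM lift_perm_lift.
rewrite /marked_sum (reindex _ (onW_bij _ (perm_cons_bij m))) /=.
rewrite -(pair_bigA _ (fun j s =>
  \sum_(l : {ffun 'I_n.+1 -> 'I_N}) W l (lift_perm m m s * tperm m j)%g)) /=.
(* Either [m] is its own image, and its loop contributes [\tr B], or it is removed from a longer
   cycle. *)
rewrite (bigD1_ord m) //=; congr (_ + _).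
  rewrite mulr_sumr; apply: eq_bigr => s _.
  rewrite (reindex _ (onW_bij _ (ffun_cons_bij m 'I_N))) /=.
  rewrite -(pair_bigA _ (fun a l => W (cons_l a l) (lift_perm m m s * tperm m m)%g)) /=.
  rewrite /mxtrace mulr_suml; apply: eq_bigr => a _; rewrite mulr_sumr.
  apply: eq_bigr => l _; rewrite WE cons_m; congr (_ * _).
  by apply: eq_bigr => k _; rewrite tperm1 perm1 cons_lift.
rewrite exchange_big [RHS]exchange_big /=; apply: eq_bigr => s _.
(* Writing the image of [m] as [s j] makes [j] its predecessor: the arcs from [j] to [m] and from
   [m] to [s j] merge into one arc leaving [j]. *)
rewrite (reindex_inj (@perm_inj _ s)) /=; apply: eq_bigr => j _.
rewrite (reindex _ (onW_bij _ (ffun_cons_bij m 'I_N))) /=.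
rewrite -(pair_bigA _ (fun a l => W (cons_l a l) (lift_perm m m s * tperm m (lift m (s j)))%g)) /=.
rewrite exchange_big /=; apply: eq_bigr => l _.
rewrite (bigD1 j) //= eqxx mxE mulr_suml; apply: eq_bigr => a _.
rewrite WE cons_lift (bigD1 j) //= tpermR cons_m mulrCA mulrA; congr (_ * _).
apply: eq_bigr => k kj; rewrite (negPf kj) tpermD ?cons_lift ?neq_lift //.
by rewrite (inj_eq lift_inj) (inj_eq perm_inj) eq_sym.
Qed.

(** Repeated contraction closes the cycle of a given point after absorbing [k] other points, which
    can be chosen in order in [n ^_ k] ways. *)
Lemma labelled_sum_rec M n :
  labelled_sum M n.+1 = \sum_(k < n.+1) (\tr (mx_pow M k.+1) * labelled_sum M (n - k))
                                         *+ n ^_ k.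
Proof.
(* Each contraction raises the marked power by one, so the induction needs every [j]. *)
have H j : forall p, (forall m : 'I_p.+1, marked_sum M (mx_pow M j.+1) m =
    \sum_(k < p.+1) (\tr (mx_pow M (j + k).+1) * labelled_sum M (p - k)) *+ p ^_ k).
  move=> p; elim: p j => [|p IHp] j m; rewrite marked_sum_contract.
    by rewrite big_ord0 big_ord1 addr0 addn0 ffactn0 mulr1n.
  rewrite [RHS]big_ord_recl /= addn0 subn0 ffactn0 mulr1n; congr (_ + _).
  rewrite (eq_bigr _ (fun k _ => IHp j.+1 k)) sumr_const card_ord -sumrMnl.
  apply: eq_bigr => k _; rewrite -mulrnA ffactSS mulnC.
  by rewrite addSnnS subSS.
have := H 0%N n ord0.
by have -> : mx_pow M 1 = M; rewrite ?marked_sum_id // /mx_pow /= mulmx1.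
Qed.

End LabelledSums.

(** * Standardization of words *)

Section Standardization.
Local Open Scope nat_scope.
Variables (n N : nat).
Implicit Types (V l : {ffun 'I_n -> 'I_N}) (s t : 'S_n) (i j p q : 'I_n).

Definition lexlt l (k : 'I_n -> 'I_n) i j : bool :=
  (l i < l j) || ((l i == l j) && (k i < k j)).

Let below V p := [set q | lexlt V id q p].

Let below_sub V p q : (below V p \subset below V q) = ~~ lexlt V id q p.
Proof.
apply/fintype.subsetP/idP => [sub|].
  apply/negP => qp; have := sub q; rewrite !inE qp => /(_ isT).
  by rewrite /lexlt !ltnn andbF.
rewrite /lexlt => qp x; rewrite !inE /lexlt -!val_eqE /=.
move: qp; rewrite -!val_eqE /=; lia.
Qed.

Let below_card V p q : (#|below V p| <= #|below V q|) = ~~ lexlt V id q p.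
Proof.
case: (boolP (lexlt V id q p)) => qp /=; last first.
  by apply: subset_leq_card; rewrite below_sub.
apply/negbTE; rewrite -ltnNge; apply: proper_card; rewrite properE !below_sub.
rewrite qp andbT; move: qp; rewrite /lexlt -!val_eqE /=; lia.
Qed.

Fact std_rank_lt V p : #|below V p| < n.
Proof.
rewrite -[X in _ < X]card_ord -cardsT; apply: proper_card.
rewrite properE finset.subsetT /=; apply/subsetPn; exists p; rewrite ?inE //.
by rewrite /lexlt !ltnn andbF.
Qed.

Definition std_rank V p : 'I_n := Ordinal (std_rank_lt V p).

Fact std_rank_inj V : injective (std_rank V).
Proof.
move=> p q /(congr1 val) /= E; apply: val_inj.
have := below_card V p q; have := below_card V q p.
rewrite E leqnn /lexlt -!val_eqE /=; lia.
Qed.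

(** Positions listed by increasing letter, equal letters from left to right. *)
Definition std V : 'S_n := (perm (@std_rank_inj V))^-1%g.

Lemma std_lexlt V i j : (i < j) = lexlt V id (std V i) (std V j).
Proof.
rewrite -[RHS]negbK -below_card -ltnNge.
have E k : #|below V (std V k)| = k.
  by rewrite -[LHS]/(val (std_rank V _)) -(permE (@std_rank_inj V)) permKV.
by rewrite !E.
Qed.

Definition lex_sorted l s : bool :=
  [forall i : 'I_n, forall j : 'I_n, (i < j) ==> lexlt l s i j].

Lemma ord_perm_mono s : (forall i j, i < j -> s i < s j) -> s = 1%g.
Proof.
move=> smono; have ge i : i <= s i.
  case: i => m; elim: m => [//|m IHm] ltm /=.
  have ltm' : m < n by apply: ltn_trans ltm.
  exact: leq_ltn_trans (IHm ltm') (smono (Ordinal ltm') (Ordinal ltm) _).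
apply/permP => i; rewrite perm1; apply: val_inj => /=.
case: i => m ltm; have [k] := ubnP (n - m); elim: k m ltm => // k IHk m ltm km.
apply/eqP; rewrite eqn_leq (ge (Ordinal ltm)) andbT leqNgt; apply/negP => lts.
have lts' := ltn_ord (s (Ordinal ltm)).
have E := IHk _ lts'; have : s (Ordinal lts') = Ordinal lts'.
  by apply: val_inj; apply: E => /=; simpl in lts; lia.
rewrite (_ : Ordinal lts' = s (Ordinal ltm)); last exact: val_inj.
by move/perm_inj/(congr1 val) => /= E'; rewrite E' /= ltnn in lts.
Qed.

(** Both [s] and [std V] list the positions in the same strict order (letter, then position), so
    [s * (std V)^-1] is increasing and hence the identity. *)
Lemma lex_sortedP V s : lex_sorted [ffun i => V (s i)] s = (s == std V).
Proof.
apply/idP/eqP => [/'forall_forallP sorted|->]; last first.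
  apply/'forall_forallP => i j; apply/implyP.
  by rewrite (std_lexlt V) /lexlt !ffunE.
suff E : (s * (std V)^-1 = 1)%g by rewrite -[s]mulg1 -(mulVg (std V)) mulgA E mul1g.
apply: ord_perm_mono => i j /(implyP (sorted i j)).
by rewrite (std_lexlt V) !permM !permKV /lexlt !ffunE.
Qed.

(** A sorted pair amounts to a word: [l] is [V] read along [s], and [s] is recovered by
    standardizing [V]. *)
Lemma sum_lex_sorted (R : nmodType) (F : 'S_n -> {ffun 'I_n -> 'I_N} -> R) :
  (\sum_s \sum_(l | lex_sorted l s) F s l = \sum_V F (std V) [ffun i => V (std V i)])%R.
Proof.
transitivity (\sum_s \sum_(V | s == std V) F s [ffun i => V (s i)])%R.
  apply: eq_bigr => s _.
  rewrite (reindex (fun V => [ffun i => V (s i)])) /=; last first.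
    exists (fun l => [ffun i => l (s^-1%g i)]) => l _; apply/ffunP => i.
      by rewrite !ffunE permKV.
    by rewrite !ffunE permK.
  by apply: eq_bigl => V; rewrite lex_sortedP.
rewrite (exchange_big_dep predT) //=; apply: eq_bigr => V _.
by rewrite big_pred1_eq.
Qed.

Definition count_lt V c := #|[set q | V q < c]|.

Definition sorted_letter V i : 'I_N := V (std V i).

(** The sorted word is weakly increasing, so its letters below [c] fill an initial segment.
    Comparing sorted words then reduces to comparing counts. *)
Lemma sorted_letter_lt V i c : (sorted_letter V i < c) = (i < count_lt V c).
Proof.
pose A := [set j | sorted_letter V j < c].
have -> : count_lt V c = #|A|.
  rewrite -(card_imset A (@perm_inj _ (std V))); apply: eq_card => q.
  rewrite !inE; apply/idP/imsetP => [Vq|[j]]; last by rewrite inE => jA ->.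
  by exists ((std V)^-1%g q); rewrite ?inE /sorted_letter permKV.
have down (j k : 'I_n) : j <= k -> sorted_letter V j <= sorted_letter V k.
  rewrite leq_eqVlt => /orP[/eqP/val_inj -> //|].
  by rewrite (std_lexlt V) /lexlt /sorted_letter -val_eqE /=; lia.
have cardlt k : k <= n -> #|[set j : 'I_n | j < k]| = k.
  move=> kn; rewrite -sum1_card (eq_bigl (fun j : 'I_n => j < k)).
    by rewrite (big_ord_narrow kn) sum1_card card_ord.
  by move=> j; rewrite inE.
apply/idP/idP => ic.
  have -> : i < #|A| = (#|[set j : 'I_n | j < i.+1]| <= #|A|) by rewrite cardlt.
  apply/subset_leq_card/fintype.subsetP => j.
  by rewrite !inE ltnS => /down ji; apply: leq_ltn_trans ic.
rewrite -[_ < _]negbK -leqNgt; apply/negP => ci.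
have : #|A| <= i.
  rewrite -[X in _ <= X](cardlt i (ltnW (ltn_ord i))).
  apply/subset_leq_card/fintype.subsetP => j.
  by rewrite !inE => jc; rewrite ltnNge; apply/negP => /down; lia.
by rewrite leqNgt ic.
Qed.

End Standardization.

Lemma sorted_letter_eq n m N (V : {ffun 'I_n -> 'I_N}) (W : {ffun 'I_m -> 'I_N})
    (i : 'I_n) (j : 'I_m) :
  (forall c, (i < count_lt V c) = (j < count_lt W c))%N ->
  sorted_letter V i = sorted_letter W j.
Proof.
move=> E; apply: val_inj; apply/eqP; rewrite eqn_leq.
have E' c : (sorted_letter V i < c = (sorted_letter W j < c))%N.
  by rewrite !sorted_letter_lt.
by rewrite -ltnS E' ltnSn -ltnS -E' ltnSn.
Qed.

Lemma sorted_letter_perm n N (V : {ffun 'I_n -> 'I_N}) (s : 'S_n) :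
  sorted_letter [ffun i => V (s i)] =1 sorted_letter V.
Proof.
move=> i; apply: sorted_letter_eq => c; congr (_ < _)%N.
rewrite /count_lt -[RHS](card_preimset _ (@perm_inj _ s)).
by apply: eq_card => q; rewrite !inE ffunE.
Qed.

Section Averaging.
Variables (R : comNzRingType) (N : nat) (M : 'M[R]_N).

Definition word_weight n (V : {ffun 'I_n -> 'I_N}) : R :=
  \prod_i M (V i) (sorted_letter V i).

(** Conjugating the permutation makes the labels sorted; the remaining freedom
    then runs over all rearrangements of the labels. *)
Lemma labelled_sum_words n :
  labelled_sum M n = (\sum_(V : {ffun 'I_n -> 'I_N}) word_weight V) *+ n`!.
Proof.
have comp_inj (t : 'S_n) : injective (fun V : {ffun 'I_n -> 'I_N} => [ffun i => V (t i)]).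
  move=> V W /ffunP E; apply/ffunP => i.
  by have := E (t^-1%g i); rewrite !ffunE permKV.
transitivity (\sum_(t : 'S_n) \sum_(l : {ffun 'I_n -> 'I_N})
                word_weight [ffun i => l (t i)]).
  rewrite [LHS]exchange_big [RHS]exchange_big /=; apply: eq_bigr => l _.
  (* With [t = std l * s^-1], the point [s (t j)] holds letter [j] of the sorted word, so the arc
     leaving [t j] carries factor [j] of the weight of [l] read along [t]. *)
  have h_inj : injective (fun s : 'S_n => std l * s^-1)%g by move=> s t /mulgI/invg_inj.
  rewrite [RHS](reindex_inj h_inj) /=; apply: eq_bigr => s _.
  rewrite (reindex_inj (@perm_inj _ (std l * s^-1)%g)) /=; apply: eq_bigr => j _.
  by rewrite sorted_letter_perm ffunE {2}permM permKV.
rewrite (eq_bigr (fun=> \sum_V @word_weight n V)) ?sumr_const ?card_Sn // => t _.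
by rewrite [RHS](reindex_inj (comp_inj t)).
Qed.

End Averaging.

Section MacMahon.
Variables (R : comNzRingType) (N : nat) (M : 'M[R]_N).
Hypothesis torsion_free : forall k (x : R), x *+ k.+1 = 0 -> x = 0.

Definition word_sum n : R := \sum_(V : {ffun 'I_n -> 'I_N}) word_weight M V.

Lemma mulrn_inj k : (0 < k)%N -> injective (fun x : R => x *+ k).
Proof.
case: k => // k _ x y /eqP; rewrite -subr_eq0 -mulrnBl => /eqP /torsion_free.
by move/eqP; rewrite subr_eq0 => /eqP.
Qed.

Lemma word_sum0 : word_sum 0 = 1.
Proof.
rewrite /word_sum (eq_bigr (fun=> 1)) => [|V _]; last by rewrite /word_weight big_ord0.
by rewrite sumr_const card_ffun !card_ord expn0.
Qed.

(** The labelled recurrence divided by n!, since n ^_ k times (n - k)! is n!; torsion-freeness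
    permits the division. *)
Lemma word_sum_rec n :
  word_sum n.+1 *+ n.+1 = \sum_(k < n.+1) \tr (mx_pow M k.+1) * word_sum (n - k).
Proof.
apply: (@mulrn_inj n`! (fact_gt0 n)) => /=.
rewrite -mulrnA -factS -labelled_sum_words labelled_sum_rec -sumrMnl.
apply: eq_bigr => k _; rewrite labelled_sum_words mulrnAr -mulrnA; congr (_ *+ _).
by rewrite mulnC ffact_fact // -ltnS.
Qed.

(** The Euler operator multiplies the word series by the trace series and the determinant by its
    opposite. The product is therefore constant, with value 1 at u = 0. *)
Theorem macmahon_master : FPS word_sum * \det (one_sub_mx M) = 1.
Proof.
have euler_words : euler_op (FPS word_sum) = trace_series M * FPS word_sum.
  apply: fpsP => -[|n]; first by rewrite fpsME big_ord1 mul0r.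
  rewrite -[LHS]/(word_sum n.+1 *+ n.+1) word_sum_rec fpsME [RHS]big_ord_recl.
  rewrite -[X in _ = X * _ + _]/(0 : R) mul0r add0r.
  by apply: eq_bigr.
rewrite [LHS](euler_op_eq0 torsion_free); last first.
  rewrite euler_opM euler_words euler_det_one_sub mulrN mulrCA -mulrA.
  exact: subrr.
congr fpsC; rewrite fpsME big_ord1 -[FPS _ _]/(word_sum 0) word_sum0 mul1r.
rewrite -[LHS]/(fps_nth 0 (\det (one_sub_mx M))).
have nthM : monoid_morphism (@fps_nth R 0).
  by split=> // f g; rewrite /fps_nth fpsME big_ord1.
pose rm := GRing.isMonoidMorphism.Build (fps R) R (@fps_nth R 0) nthM.
pose c0 : {rmorphism fps R -> R} := HB.pack (@fps_nth R 0) rm.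
rewrite -[LHS]/(c0 _) -det_map_mx [map_mx _ _](_ : _ = 1%:M) ?det1 //.
apply/matrixP => i j; rewrite !mxE.
rewrite -[LHS]/(((i == j)%:R : fps R) 0%N - (fpsX * fpsC (M i j)) 0%N) fpsXM subr0 fpsMnE.
by rewrite fps1E.
Qed.

End MacMahon.

(** * Words without fixed points at block starts *)

Section LeadingFixedPoints.
Variables (N : nat).

(** In terms of the permutation [std V], this is a fixed point at the first
    position of the block of letters [b]. *)
Definition starts_fixed n (V : {ffun 'I_n -> 'I_N}) (b : 'I_N) : bool :=
  [exists p : 'I_n, (p == count_lt V b :> nat) && (V p == b)].

Definition insert_letter n (p : 'I_n.+1) (a : 'I_N) (V : {ffun 'I_n -> 'I_N}) :
    {ffun 'I_n.+1 -> 'I_N} :=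
  [ffun i => if unlift p i is Some k then V k else a].

Section Insertion.
Variables (n : nat) (p : 'I_n.+1) (a : 'I_N) (V : {ffun 'I_n -> 'I_N}).
Local Notation V' := (insert_letter p a V).

Lemma insert_letter_at : V' p = a.
Proof. by rewrite ffunE unlift_none. Qed.

Lemma insert_letter_lift k : V' (lift p k) = V k.
Proof. by rewrite ffunE liftK. Qed.

Lemma count_lt_insert c : count_lt V' c = (count_lt V c + (a < c))%N.
Proof.
rewrite /count_lt -!sum1_card !big_mkcond (bigD1_ord p) //= !inE insert_letter_at.
rewrite addnC; congr addn; rewrite [RHS]big_mkcond /=.
by apply: eq_bigr => k _; rewrite !inE insert_letter_lift.
Qed.

Hypothesis pE : p = count_lt V a :> nat.

Lemma leq_count_lt (c d : nat) : (c <= d)%N -> (count_lt V c <= count_lt V d)%N.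
Proof.
move=> cd; apply/subset_leq_card/fintype.subsetP => q; rewrite !inE => h.
exact: leq_trans cd.
Qed.

Lemma sorted_letter_insert_at : sorted_letter V' p = a.
Proof.
apply: val_inj; apply/eqP; rewrite eqn_leq -ltnS sorted_letter_lt count_lt_insert.
rewrite pE ltnSn addn1 ltnS leq_count_lt //=.
by rewrite leqNgt sorted_letter_lt count_lt_insert pE ltnn addn0 ltnn.
Qed.

Lemma sorted_letter_insert_lift k :
  sorted_letter V' (lift p k) = sorted_letter V k.
Proof.
apply: sorted_letter_eq => c; rewrite count_lt_insert /= /bump pE.
have := @leq_count_lt c a; have := @leq_count_lt a c.
case: (ltnP a c) => ac; case: (leqP (count_lt V a) k) => /=; lia.
Qed.

Lemma word_weight_insert (R : comNzRingType) (M : 'M[R]_N) :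
  word_weight M V' = M a a * word_weight M V.
Proof.
rewrite /word_weight (bigD1_ord p) //= insert_letter_at sorted_letter_insert_at.
congr (_ * _); apply: eq_bigr => k _.
by rewrite insert_letter_lift sorted_letter_insert_lift.
Qed.

(** If [a < b], the start of block [b] and a fixed position there both move by one; if [b < a], they
    lie before the insertion point and do not move. *)
Lemma starts_fixed_insert b : b != a -> starts_fixed V' b = starts_fixed V b.
Proof.
move=> ba; have ltcount k : V k = b -> (b < a)%N -> (count_lt V b < count_lt V a)%N.
  move=> Vk lba; apply: proper_card; rewrite properE; apply/andP; split.
    by apply/fintype.subsetP => q; rewrite !inE => /ltn_trans; apply.
  by apply/subsetPn; exists k; rewrite !inE Vk ?ltnn.
have nba : (b == a :> nat) = false by apply/negbTE.
apply/existsP/existsP => -[q /andP[/eqP qE /eqP Vq]].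
  case: (unliftP p q) => [k qk|qp]; last first.
    by move: Vq ba; rewrite qp insert_letter_at => ->; rewrite eqxx.
  move: Vq qE; rewrite qk insert_letter_lift count_lt_insert /= /bump pE => Vk kE.
  exists k; rewrite Vk eqxx andbT; have := ltcount k Vk; have := @leq_count_lt a b.
  by move: kE; case: (ltnP a b) => ab; case: (leqP (count_lt V a) k) => /=; lia.
exists (lift p q); rewrite insert_letter_lift Vq eqxx andbT count_lt_insert /= /bump pE.
have := ltcount q Vq; have := @leq_count_lt a b.
by move: qE; case: (ltnP a b) => ab; case: (leqP (count_lt V a) q) => /=; lia.
Qed.

End Insertion.

Variables (R : comNzRingType) (M : 'M[R]_N).

Definition restricted_word_sum (S : seq 'I_N) n : R :=
  \sum_(V : {ffun 'I_n -> 'I_N} | all (fun b => ~~ starts_fixed V b) S) word_weight M V.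

(** A word whose block [a] starts with a fixed point comes from exactly one shorter word, by
    inserting [a] at position [count_lt V a]. As [a] is not in [S], the insertion preserves the
    conditions from [S]. *)
Lemma restricted_word_sum_cons a S n : a \notin S ->
  restricted_word_sum S n.+1 =
  restricted_word_sum (a :: S) n.+1 + M a a * restricted_word_sum S n.
Proof.
move=> aS; rewrite /restricted_word_sum.
rewrite (bigID (fun V => starts_fixed V a)) /= addrC; congr (_ + _).
  by apply: eq_bigl => V; rewrite andbC.
transitivity (\sum_(p < n.+1) \sum_(V : {ffun 'I_n.+1 -> 'I_N} |
    all (fun b => ~~ starts_fixed V b) S && ((p == count_lt V a :> nat) && (V p == a)))
      word_weight M V).
  rewrite (exchange_big_dep (fun V => all (fun b => ~~ starts_fixed V b) S
                                      && starts_fixed V a)) /=; last first.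
    by move=> p V _ /andP[-> h] /=; apply/existsP; exists p.
  apply: eq_bigr => V /andP[VS /existsP[p /andP[/eqP pE /eqP Vp]]].
  rewrite (big_pred1 p) // => q; rewrite VS /=.
  apply/andP/eqP => [[/eqP qE _]|->]; last by rewrite pE Vp !eqxx.
  by apply: val_inj => /=; rewrite qE pE.
transitivity (\sum_(p < n.+1) \sum_(V : {ffun 'I_n -> 'I_N} |
    (p == count_lt V a :> nat) && all (fun b => ~~ starts_fixed V b) S)
      M a a * word_weight M V).
  apply: eq_bigr => p _.
  rewrite (reindex _ (onW_bij _ (ffun_cons_bij p 'I_N))) /=.
  rewrite (eq_bigl (fun q : 'I_N * {ffun 'I_n -> 'I_N} => (q.1 == a) &&
    ((p == count_lt q.2 a :> nat) && all (fun b => ~~ starts_fixed q.2 b) S))); last first.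
    move=> [c V] /=; rewrite -/(insert_letter p c V) insert_letter_at count_lt_insert.
    case: (eqVneq c a) => [->|]; last by rewrite !andbF.
    rewrite ltnn addn0 andbT andbC; case: eqP => //= pE; apply: eq_in_all => b bS.
    by rewrite starts_fixed_insert //; apply: contraNneq aS => <-.
  rewrite -(pair_big_dep (fun c => c == a) (fun c V => (p == count_lt V a :> nat) && 
     all (fun b => ~~ starts_fixed V b) S) (fun c V => word_weight M (insert_letter p c V))) /=.
  rewrite big_pred1_eq; apply: eq_bigr => V /andP[/eqP pE _].
  by rewrite word_weight_insert.
rewrite (exchange_big_dep (fun V => all (fun b => ~~ starts_fixed V b) S)) /=; last first.
  by move=> p V _ /andP[].
rewrite mulr_sumr; apply: eq_bigr => V VS.
have ltc : (count_lt V a < n.+1)%N.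
  by rewrite ltnS -[X in (_ <= X)%N]card_ord; exact: max_card.
rewrite (big_pred1 (Ordinal ltc)) // => p.
by rewrite VS andbT.
Qed.

Lemma restricted_word_sum0 S : restricted_word_sum S 0 = 1.
Proof.
rewrite /restricted_word_sum (eq_bigr (fun=> 1)) => [|V _]; last first.
  by rewrite /word_weight big_ord0.
rewrite (eq_bigl predT) ?sumr_const ?card_ffun ?card_ord ?expn0 //.
by move=> V; apply/allP => b _; apply/existsP => -[[]].
Qed.

Lemma restricted_word_series S : uniq S ->
  FPS (restricted_word_sum S) =
  \prod_(a <- S) (1 - fpsC (M a a) * fpsX) * FPS (word_sum M).
Proof.
elim: S => [|a S IHS] /=.
  by move=> _; rewrite big_nil mul1r; apply: fpsP => n; apply: eq_bigl.
case/andP=> aS /IHS{}IHS; rewrite big_cons -mulrA -IHS; apply: fpsP => n.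
rewrite mulrBl mul1r -mulrA -[RHS]/(restricted_word_sum S n - (fpsC _ * (fpsX * _)) n).
rewrite fpsCM fpsXM; case: n => [|n]; first by rewrite mulr0 subr0 /= !restricted_word_sum0.
by rewrite /= (restricted_word_sum_cons _ aS) addrK.
Qed.

End LeadingFixedPoints.

(** * Excedances of words *)

Section StepDeterminant.
Variable R : comNzRingType.
Implicit Types (d s l v : nat -> R).

Definition hessenberg_mx d s l n : 'M[R]_n.+1 :=
  \matrix_(i, j) (if i == n :> nat then l j
                  else if j == i :> nat then d i
                  else if j == i.+1 :> nat then - s i else 0).

(** Expansion along the first column, which has at most two nonzero entries: the corner leads to a
    smaller matrix of the same shape, the bottom entry to a triangular minor whose signs cancel
    those of the cofactor. *)
Lemma det_hessenberg d s l n :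
  \det (hessenberg_mx d s l n) =
  \sum_(j < n.+1) l j * \prod_(b < j) d b * \prod_(j <= b < n) s b.
Proof.
elim: n d s l => [|n IHn] d s l.
  by rewrite det_mx11 !mxE /= big_ord1 big_ord0 big_geq // !mulr1.
rewrite (expand_det_col _ ord0) big_ord_recl big_ord_recr /= big1 ?add0r; last first.
  move=> i _; rewrite !mxE /= /bump /= add1n eqSS ltn_eqF ?mul0r //.
rewrite addrC [RHS]big_ord_recl; congr (_ + _).
  rewrite !mxE /= /bump /= add1n eqxx big_ord0 mulr1 /cofactor /= /bump /= add1n addn0.
  congr (_ * _); rewrite [X in \det X](_ : _ = (\matrix_(i < n.+1, j < n.+1)
     (if j == i :> nat then - s i else if j.+1 == i :> nat then d i else 0))); last first.
    apply/matrixP => i j; rewrite !mxE /= /bump /= add1n.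
    rewrite [(n.+1 <= i)%N]leqNgt ltn_ord add0n ltn_eqF // !eqSS.
    by rewrite add1n; case: (eqVneq (j : nat) i) => [->|_] //; rewrite gtn_eqF.
  rewrite det_trig; last first.
    apply/is_trig_mxP => i j ij; rewrite !mxE gtn_eqF // gtn_eqF //.
    exact: ltn_trans ij _.
  rewrite (eq_bigr (fun i : 'I_n.+1 => - s i)) => [|i _]; last by rewrite !mxE eqxx.
  by rewrite prodrN card_ord mulrA -expr2 sqrr_sign mul1r big_mkord.
rewrite /cofactor expr0 mul1r mxE /=.
rewrite [X in \det X](_ : _ = hessenberg_mx (d \o succn) (s \o succn) (l \o succn) n).
  rewrite IHn mulr_sumr; apply: eq_bigr => j _.
  rewrite big_ord_recl /= big_add1 /=; ring.
by apply/matrixP => i j; rewrite !mxE /= /bump /= !add1n !eqSS.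
Qed.

(** Even letters may only be sent to smaller or equal letters, odd letters only
    to larger or equal ones. Consecutive columns differ in two entries at most,
    so that taking differences of columns gives a Hessenberg matrix. *)
Definition step_mx v n : 'M[R]_n :=
  \matrix_(a, b) (v a *+ (if odd a then (a <= b)%N else (b <= a)%N)).

Fixpoint step_det v k : R :=
  if k is k'.+1 then
    (1 - v k'.*2.+1) * (step_det v k' - v k'.*2 * \prod_(i < k') (1 - v i.*2))
  else 1.

Lemma det_one_sub_step v k : \det (1%:M - step_mx v k.*2) = step_det v k.
Proof.
case: k => [|k]; first by rewrite det_mx00.
rewrite -det_tr doubleS; set n := k.*2.+1; set A := _^T.
(* Left multiplication by [U] subtracts from each row of the transpose the next row, which takes
   differences of columns of the original matrix. *)
pose U : 'M[R]_n.+1 := \matrix_(i, j) ((j == i)%:R - (j == i.+1 :> nat)%:R).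
have detU : \det U = 1.
  rewrite -det_tr det_trig.
    by rewrite big1 // => i _; rewrite !mxE eqxx ltn_eqF ?subr0.
  apply/is_trig_mxP => i j ij; rewrite !mxE -val_eqE /= ltn_eqF // ltn_eqF ?subr0 //.
  exact: ltnW.
rewrite -[LHS]mul1r -detU -det_mulmx.
pose d b := if odd b then 1 else 1 - v b.
pose s b := if odd b then 1 else 1 - v b.+1.
pose l a := (a == n)%:R - v a *+ odd a.
have -> : U *m A = hessenberg_mx d s l n.
  apply/matrixP => i j; rewrite !mxE.
  rewrite (bigD1 i) //= mxE eqxx ltn_eqF // subr0 mul1r.
  case: (eqVneq (i : nat) n) => [iE|ine].
    rewrite big1 ?addr0 => [|p pi]; last first.
      by rewrite !mxE (negPf pi) sub0r ltn_eqF ?oppr0 ?mul0r // iE ltn_ord.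
    rewrite !mxE /l -val_eqE /= iE; congr (_ - _ *+ _).
    case: ifP => oj; first by rewrite -ltnS ltn_ord.
    rewrite leqNgt ltn_neqAle -ltnS ltn_ord andbT negbK.
    by apply/eqP; rewrite eqb0; apply/eqP => jE; rewrite jE /= odd_double in oj.
  have lti : (i.+1 < n.+1)%N by rewrite ltnS ltn_neqAle ine -ltnS ltn_ord.
  rewrite (bigD1 (Ordinal lti)) /=; last by rewrite -val_eqE /= gtn_eqF.
  rewrite big1 ?addr0 => [|p /andP[pi pSi]]; last first.
    rewrite !mxE (negPf pi) sub0r (_ : (p == i.+1 :> nat) = false) ?oppr0 ?mul0r //.
    by apply/negbTE.
  rewrite !mxE eqxx -!val_eqE /= (gtn_eqF (ltnSn i)) sub0r mulN1r /d /s.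
  have [ji|ij|->] := ltngtP (j : nat) i.
  - have [-> ->] : (j == i.+1 :> nat) = false /\ (j <= i.+1)%N by split; lia.
    by rewrite subrr.
  - have [->|nj] := eqVneq (j : nat) i.+1.
      by rewrite /= leqnn; case: (odd i) => /=; rewrite ?mulr0n ?mulr1n; ring.
    have -> : (j <= i.+1)%N = false by move/eqP: nj; lia.
    by rewrite subrr.
  - by rewrite (ltn_eqF (ltnSn i)) leqnSn; case: (odd i); rewrite ?mulr0n ?mulr1n; ring.
rewrite det_hessenberg.
pose P m := \prod_(i < m) (1 - v i.*2).
(* The delta term of the last row [l] will give the product of the [d b]; [G m] is the contribution
   of its other part for [m] letters, the last of index [m.-1]. *)
pose G m := \sum_(j < m) - (v j *+ odd j) * \prod_(b < j) d b * \prod_(j <= b < m.-1) s b.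
have dP m : \prod_(b < m.*2) d b = P m.
  elim: m => [|m IHm]; first by rewrite /P !big_ord0.
  by rewrite doubleS !big_ord_recr /= IHm /P big_ord_recr /d /= odd_double /= mulr1.
have GS m : (0 < m)%N -> G m.+1 = s m.-1 * G m - (v m *+ odd m) * \prod_(b < m) d b.
  case: m => // m _; rewrite /G big_ord_recr /= big_geq // mulr1 mulNr mulr_sumr.
  congr (_ - _); apply: eq_bigr => j _.
  by rewrite big_nat_recr -1?ltnS //= mulrC mulrA mulrAC -mulrA mulrCA !mulrA; ring.
have -> : \sum_(j < n.+1) l j * \prod_(b < j) d b * \prod_(j <= b < n) s b =
    \prod_(b < n) d b + G n.+1.
  have -> : \prod_(b < n) d b =
      \sum_(j < n.+1) (j == n :> nat)%:R * \prod_(b < j) d b * \prod_(j <= b < n) s b.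
    rewrite [RHS](bigD1 ord_max) //= eqxx big_geq // mul1r mulr1.
    rewrite [X in _ = _ + X]big1 ?addr0 // => j jn.
    rewrite (_ : (j == n :> nat) = false) ?mul0r //.
    by apply: negbTE; apply: contraNneq jn => jn; apply/eqP/val_inj.
  by rewrite /G -big_split; apply: eq_bigr => j _; rewrite /l /= -!mulrDl.
have main m : \prod_(b < m.*2.+1) d b + G m.*2.+2 = step_det v m.+1.
  elim: m => [|m IHm].
    rewrite /= /G !big_ord_recl !big_ord0 /= big_nat1 big_geq // /d /s /=.
    by rewrite ?mulr0n ?mulr1n; ring.
  have -> : step_det v m.+2 = (1 - v m.+1.*2.+1) *
      (step_det v m.+1 - v m.+1.*2 * P m.+1) by [].
  rewrite -IHm GS // GS // big_ord_recr /= dP.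
  have -> : \prod_(b < m.*2.+1) d b = P m.+1.
    by rewrite big_ord_recr /= dP /P big_ord_recr /d /= odd_double.
  rewrite /d /s /= odd_double /= ?mulr0n ?mulr1n.
  rewrite !doubleS;
  ring.
exact: main.
Qed.

End StepDeterminant.

(** * Excedances inside blocks of equal letters *)

Section LexSorted.
Local Open Scope nat_scope.
Variables (n N : nat) (l : {ffun 'I_n -> 'I_N}) (s : 'S_n).
Hypothesis ls : lex_sorted l s.

Lemma lex_sorted_leq (i j : 'I_n) : i <= j -> l i <= l j.
Proof.
rewrite leq_eqVlt => /orP[/eqP/val_inj -> //|ij].
have /'forall_forallP/(_ i j)/implyP/(_ ij) := ls.
by rewrite /lexlt => /orP[/ltnW//|/andP[/eqP -> _]].
Qed.

Lemma lex_sorted_lt (i j : 'I_n) : i < j -> l i = l j -> s i < s j.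
Proof.
move=> ij lij; have /'forall_forallP/(_ i j)/implyP/(_ ij) := ls.
by rewrite /lexlt lij ltnn eqxx.
Qed.

(** Along a block [s] increases strictly, so the difference [s i - i] cannot decrease. *)
Lemma lex_sorted_exc (i j : 'I_n) : i <= j -> l i = l j -> i < s i -> j < s j.
Proof.
move=> ij lij si; case: j ij lij => j jn /= ij lij.
elim: j jn ij lij => [|j IHj] jn.
  by rewrite leqn0 => /eqP i0 lij; rewrite [Ordinal jn](_ : _ = i) -?i0 //; apply: val_inj.
rewrite leq_eqVlt => /orP[/eqP ij|].
  by rewrite [Ordinal jn](_ : _ = i) -?ij //; apply: val_inj.
rewrite ltnS => ij lij; have jn' := ltnW jn.
have lj : l (Ordinal jn') = l i.
  apply: val_inj; apply/eqP; rewrite eqn_leq [X in _ && X]lex_sorted_leq // andbT lij.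
  exact: lex_sorted_leq.
apply: leq_ltn_trans (IHj jn' ij (esym lj)) _; apply: lex_sorted_lt => //=.
by rewrite lj lij.
Qed.

End LexSorted.

Section SignedLetters.
Local Open Scope nat_scope.
Variables (n N : nat) (V : {ffun 'I_n -> 'I_N}).

(** Even letters mark non-excedances and odd letters excedances. Inside a block
    of equal letters the permutation increases, so being an excedance only
    depends on the block containing the image, up to the fixed points excluded
    by [starts_fixed]. *)
Definition reaches (a b : nat) := if odd a then a <= b else b <= a.

Definition even_odd_exc (l : {ffun 'I_n -> 'I_N}) (s : 'S_n) : bool :=
  [forall i : 'I_n, odd (l i) == (i < s i)].

Lemma even_odd_excP :
  even_odd_exc [ffun i => V (std V i)] (std V) =
  [forall p, reaches (V p) (sorted_letter V p)] &&
  [forall b : 'I_N, odd b ==> ~~ starts_fixed V b].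
Proof.
set l := [ffun i => _]; set s := std V.
have ls : lex_sorted l s by rewrite lex_sortedP.
have lE i : V (s i) = l i by rewrite ffunE.
have lt_count (p : 'I_n) c : (l p < c) = (p < count_lt V c).
  by rewrite -sorted_letter_lt ffunE.
apply/'forall_eqP/andP => [exc|[/forallP cond /forallP nstart]]; first split.
- apply/forallP => p; rewrite -[p](permKV s) lE /sorted_letter -/s lE /reaches exc.
  set i := (s^-1)%g p; case: ltnP => isi.
    exact: (lex_sorted_leq ls (ltnW isi)).
  exact: (lex_sorted_leq ls isi).
- apply/forallP => b; apply/implyP => ob; apply/negP => /existsP[p /andP[/eqP pE /eqP Vp]].
  set i := (s^-1)%g p; have si : s i = p by rewrite permKV.
  have li : l i = b by rewrite -lE si.
  have : i < s i by rewrite -exc li.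
  by rewrite si pE -lt_count li ltnn.
have {}cond i : reaches (l i) (l (s i)).
  by have := cond (s i); rewrite lE /sorted_letter -/s lE.
have {}nstart i : odd (l i) -> s i <> count_lt V (l i) :> nat.
  move=> oi E; have /implyP/(_ oi)/existsP[] := nstart (l i).
  by exists (s i); rewrite E lE !eqxx.
(* An excedance at an even letter would force the next position to lie in the same block and to be
   an excedance too, up to the last position, where there is none. *)
have even_case k : forall i : 'I_n, n - i <= k -> ~~ odd (l i) -> s i <= i.
  elim: k => [|k IHk] i; first by rewrite leqn0 subn_eq0 leqNgt ltn_ord.
  move=> ik oi; rewrite leqNgt; apply/negP => isi.
  have i1n : i.+1 < n by apply: leq_ltn_trans (ltn_ord (s i)).
  have := cond i; rewrite /reaches (negPf oi) => lsi.
  have lj : l (Ordinal i1n) = l i.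
    apply: val_inj; apply/eqP; rewrite eqn_leq; apply/andP; split.
      by apply: leq_trans lsi; apply: (lex_sorted_leq ls).
    by apply: (lex_sorted_leq ls) => /=.
  have := IHk (Ordinal i1n); rewrite lj => /(_ _ oi) /=.
  have := @lex_sorted_lt _ _ _ _ ls i (Ordinal i1n); rewrite lj /= => /(_ (ltnSn i) erefl).
  by move: ik isi; lia.
(* A non-excedance at an odd letter would pass to the previous position of its block, down to the
   block start, where it would be the excluded fixed point. *)
have odd_case k : forall i : 'I_n, i <= k -> odd (l i) -> i < s i.
  elim: k => [|k IHk] i ik oi; rewrite ltnNge; apply/negP => sii.
    have := cond i; rewrite /reaches oi leqNgt lt_count -leqNgt.
    by have := nstart i oi; lia.
  have := cond i; rewrite /reaches oi leqNgt lt_count -leqNgt => csi.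
  have := nstart i oi => ncs.
  have ltci : count_lt V (l i) < i.
    by apply: leq_trans sii; rewrite ltn_neqAle csi andbT eq_sym; apply/eqP.
  have j_lt : i.-1 < n by apply: leq_ltn_trans (leq_pred i) (ltn_ord i).
  have lj : l (Ordinal j_lt) = l i.
    apply: ord_inj; apply/eqP; rewrite eqn_leq; apply/andP; split.
      by apply: (lex_sorted_leq ls); exact: leq_pred.
    rewrite leqNgt lt_count /= -leqNgt -ltnS (ltn_predK ltci).
    exact: ltci.
  have := IHk (Ordinal j_lt); rewrite lj /= => /(_ _ oi).
  have := @lex_sorted_lt _ _ _ _ ls (Ordinal j_lt) i; rewrite lj /= => /(_ _ erefl).
  by lia.
move=> i; case oi: (odd (l i)); first by rewrite (odd_case i).
by rewrite ltnNge (even_case n) ?leq_subr ?oi.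
Qed.

End SignedLetters.

(** Letter [k] is split into [2 * k] and [2 * k + 1]: in a block of equal letters
    the excedances come last, so this is compatible with the order. *)
Section ExcedanceSeries.
Variables (R : comNzRingType) (alpha beta : nat -> R) (K : nat).
Hypothesis torsion_free : forall k (x : R), x *+ k.+1 = 0 -> x = 0.

Definition exc_sum n : R :=
  \sum_(s : 'S_n) \sum_(l : {ffun 'I_n -> 'I_K} | lex_sorted l s)
    \prod_(i < n) (if (i < s i)%N then beta (l i) else alpha (l i)).

Definition signed_weight (a : nat) : R := if odd a then beta a./2 else alpha a./2.

Fact double_letter_lt (a : 'I_K) (b : bool) : (b + a.*2 < K.*2)%N.
Proof. by have := ltn_ord a; lia. Qed.

Definition double_letter a b : 'I_(K.*2) := Ordinal (double_letter_lt a b).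

Fact half_letter_lt (a : 'I_(K.*2)) : (a./2 < K)%N.
Proof. by have := ltn_ord a; lia. Qed.

Definition half_letter a : 'I_K := Ordinal (half_letter_lt a).

Lemma lex_sorted_double n (s : 'S_n) (l : {ffun 'I_n -> 'I_K}) :
  lex_sorted [ffun i : 'I_n => double_letter (l i) (i < s i)%N] s = lex_sorted l s.
Proof.
apply/idP/idP => ls; apply/'forall_forallP => i j; apply/implyP => ij.
  have /'forall_forallP/(_ i j)/implyP/(_ ij) := ls.
  rewrite /lexlt !ffunE -!val_eqE /=.
  by case: (ltnP i (s i)) => isi; case: (ltnP j (s j)) => jsj; lia.
have := lex_sorted_leq ls (ltnW ij); have := @lex_sorted_exc _ _ _ _ ls i j (ltnW ij).
have := lex_sorted_lt ls ij.
rewrite /lexlt !ffunE -!val_eqE /= => slt exc.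
rewrite leq_eqVlt => /orP[/eqP/val_inj lij|]; last first.
  by case: (ltnP i (s i)); case: (ltnP j (s j)); lia.
rewrite lij (slt lij); move/(_ lij): exc.
by case: (ltnP i (s i)); case: (ltnP j (s j)) => ? ? /=; lia.
Qed.

Lemma exc_sum_signed n :
  exc_sum n = \sum_(s : 'S_n) \sum_(l : {ffun 'I_n -> 'I_(K.*2)} |
                 lex_sorted l s && even_odd_exc l s) \prod_i signed_weight (l i).
Proof.
apply: eq_bigr => s _.
rewrite [RHS](reindex_onto (fun l : {ffun 'I_n -> 'I_K} =>
    [ffun i : 'I_n => double_letter (l i) (i < s i)%N])
  (fun l : {ffun 'I_n -> 'I_(K.*2)} => [ffun i => half_letter (l i)])) /=; last first.
  move=> l /andP[_ /'forall_eqP exc]; apply/ffunP => i; rewrite !ffunE.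
  by apply: val_inj; rewrite /= -exc odd_double_half.
apply: eq_big => [l|l _].
  rewrite lex_sorted_double -andbA; apply/esym; rewrite [X in _ && X](_ : _ = true) ?andbT //.
  apply/andP; split.
    by apply/'forall_eqP => i; rewrite !ffunE /= oddD odd_double addbF oddb.
  apply/eqP/ffunP => i; rewrite !ffunE; apply: val_inj => /=.
  by rewrite half_bit_double.
apply: eq_bigr => i _; rewrite ffunE /signed_weight /= oddD odd_double addbF oddb.
by rewrite half_bit_double.
Qed.

Let M : 'M[R]_(K.*2) := step_mx signed_weight K.*2.

(** The parity condition splits into [reaches], which is built into the entries of [M], and the
    absence of leading fixed points at odd letters. *)
Lemma exc_sum_words n :
  exc_sum n = restricted_word_sum M [seq a : 'I_(K.*2) <- enum 'I_(K.*2) | odd a] n.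
Proof.
rewrite exc_sum_signed /restricted_word_sum.
transitivity (\sum_s \sum_(l : {ffun 'I_n -> 'I_(K.*2)} | lex_sorted l s)
    (\prod_i signed_weight (l i)) *+ even_odd_exc l s).
  apply: eq_bigr => s _; rewrite big_mkcondr; apply: eq_bigr => l _.
  by case: even_odd_exc; rewrite ?mulr0n.
rewrite (sum_lex_sorted (fun s (l : {ffun 'I_n -> 'I_(K.*2)}) =>
   (\prod_i signed_weight (l i)) *+ even_odd_exc l s)).
rewrite [RHS]big_mkcond; apply: eq_bigr => V _.
rewrite even_odd_excP (eq_bigr (fun i => signed_weight (V (std V i)))); last first.
  by move=> i _; rewrite ffunE.
have <- : \prod_i signed_weight (V i) = \prod_i signed_weight (V (std V i)).
  exact: (reindex_inj (@perm_inj _ (std V))).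
have -> : all (fun b => ~~ starts_fixed V b) [seq a : 'I_(K.*2) <- enum 'I_(K.*2) | odd a] =
          [forall b : 'I_(K.*2), odd b ==> ~~ starts_fixed V b].
  rewrite all_filter; apply/allP/forallP => [h b|h b _]; last exact: h.
  by apply: h; rewrite mem_enum.
case: ifP => _; last by rewrite andbF.
rewrite andbT /word_weight; case: (boolP [forall _, _]) => [/forallP ok|].
  by apply: eq_bigr => i _; rewrite mxE -/(reaches _ _) ok.
rewrite negb_forall => /existsP[i Hi].
by rewrite mulr0n (bigD1 i) //= mxE -/(reaches _ _) (negPf Hi) mulr0n mul0r.
Qed.

Theorem exc_series :
  FPS exc_sum * step_det (fun a => fpsX * fpsC (signed_weight a)) K =
  \prod_(k < K) (1 - fpsX * fpsC (beta k)).
Proof.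
have -> : FPS exc_sum = \prod_(k < K) (1 - fpsX * fpsC (beta k)) * FPS (word_sum M).
  transitivity (FPS (restricted_word_sum M [seq a : 'I_(K.*2) <- enum 'I_(K.*2) | odd a])).
    by apply: fpsP => n; apply: exc_sum_words.
  rewrite restricted_word_series; last by rewrite filter_uniq // enum_uniq.
  congr (_ * _).
  rewrite big_filter big_enum_cond /=.
  have E m : \prod_(a < m.*2 | odd a) (1 - fpsX * fpsC (signed_weight a)) =
      \prod_(k < m) (1 - fpsX * fpsC (beta k)).
    elim: m => [|m IHm]; first by rewrite !big_ord0.
    rewrite doubleS big_mkcond !big_ord_recr /= odd_double /= mulr1.
    by rewrite -big_mkcond IHm /signed_weight /= odd_double /= uphalf_double.
  rewrite -E; apply: eq_bigr => a oa.
  by rewrite mxE oa leqnn mulrC.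
have one_sub_mxE : one_sub_mx M =
    1%:M - step_mx (fun a => fpsX * fpsC (signed_weight a)) K.*2.
  apply/matrixP => a b; rewrite !mxE; congr (_ - _).
  by rewrite raddfMn mulrnAr.
by rewrite -det_one_sub_step -one_sub_mxE -mulrA macmahon_master // mulr1.
Qed.

End ExcedanceSeries.

(** * Weights that are periodic in the letter *)

Section PeriodicWeights.
Variables (R : comNzRingType) (r : nat).
Hypothesis r_gt0 : (0 < r)%N.

(** Letters will encode a color [c] by the residue of [- c] modulo [r]. A position of color [c > 0]
    contributes [r - c] to [r * n - fexc w]; one of color 0 contributes [r], or 0 at an
    excedance. *)
Definition nonexc_weight (y : R) (k : nat) : R :=
  if (k %% r == 0)%N then y ^+ r else y ^+ (k %% r).

Definition exc_weight (y : R) (k : nat) : R := y ^+ (k %% r).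

Variables (u y : R).
Local Notation P k := (\prod_(i < k) (1 - u * nonexc_weight y i)).
Local Notation Q k := (\prod_(i < k) (1 - u * exc_weight y i)).
Local Notation D k := (step_det (fun a => u * signed_weight (nonexc_weight y) (exc_weight y) a) k).
Local Notation G t := ((1 - u) ^+ t - y * (1 - y ^+ r * u) ^+ t).

Lemma step_detS k :
  D k.+1 = (1 - u * exc_weight y k) * (D k - u * nonexc_weight y k * P k).
Proof.
rewrite /= {1 3}/signed_weight /= odd_double /= uphalf_double.
rewrite doubleK; congr (_ * (_ - _ * _)); apply: eq_bigr => i _.
by rewrite /signed_weight odd_double doubleK.
Qed.

(** The first equation holds because [nonexc_weight] and [exc_weight] only differ
    at the multiples of [r]; the second is the partial sum of a geometric series. *)
Let invariant t e k :=
  P k * (1 - u) ^+ t.+1 = Q k * (1 - y ^+ r * u) ^+ t.+1 /\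
  (1 - y) * (1 - u) ^+ t.+1 * D k =
    Q k * ((1 - u) * (1 - y ^+ r * u) * G t - u * (y - y ^+ e) * (1 - y ^+ r * u) ^+ t.+1).

Let invariant_inner t e k :
  nonexc_weight y k = y ^+ e -> exc_weight y k = y ^+ e ->
  invariant t e k -> invariant t e.+1 k.+1.
Proof.
move=> ak bk [PQ DQ]; rewrite /invariant step_detS ![\prod_(i < k.+1) _]big_ord_recr /= ak bk.
set p := P k in PQ *; set q := Q k in PQ DQ *; set d := D k in DQ *.
move: ((1 - y ^+ r * u) ^+ t.+1) PQ DQ => b; move: (_ ^+ t.+1) => a PQ DQ.
split; first by rewrite mulrAC PQ; ring.
transitivity ((1 - u * y ^+ e) * ((1 - y) * a * d - u * y ^+ e * (1 - y) * (p * a))).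
  by ring.
by rewrite DQ PQ exprS; ring.
Qed.

(** Applied with [k = r * t.+1], a letter where the two weights differ; the geometric sum restarts
    at [e = 1]. *)
Let invariant_outer t k :
  nonexc_weight y k = y ^+ r -> exc_weight y k = 1 ->
  invariant t r k -> invariant t.+1 1 k.+1.
Proof.
move=> ak bk [PQ DQ]; rewrite /invariant step_detS ![\prod_(i < k.+1) _]big_ord_recr /= ak bk.
set p := P k in PQ *; set q := Q k in PQ DQ *; set d := D k in DQ *.
split.
  transitivity ((1 - u * y ^+ r) * (1 - u) * (p * (1 - u) ^+ t.+1)).
    by rewrite !exprS; ring.
  by rewrite PQ !exprS; ring.
transitivity ((1 - u) * (1 - u) * ((1 - y) * (1 - u) ^+ t.+1 * d
               - u * y ^+ r * (1 - y) * (p * (1 - u) ^+ t.+1))).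
  by rewrite !exprS; ring.
by rewrite DQ PQ !exprS expr0; ring.
Qed.

(** At [(r * t).+1] letters the exponent is [e = 1] and the geometric term vanishes. The factor
    [1 - u] stays on both sides until it is known to be regular. *)
Lemma step_det_period t :
  (1 - y) * (1 - u) ^+ t * D (r * t).+1 * (1 - u) =
  Q (r * t).+1 * ((1 - y ^+ r * u) * G t) * (1 - u).
Proof.
suff [_ /[!expr1]] : invariant t 1 (r * t).+1.
  rewrite subrr mulr0 mul0r subr0 exprSr => E.
  transitivity ((1 - y) * ((1 - u) ^+ t * (1 - u)) * D (r * t).+1); last by rewrite E; ring.
  set d := D _; ring.
elim: t => [|t IHt].
  rewrite muln0 /invariant step_detS !big_ord_recl !big_ord0 /=.
  rewrite /nonexc_weight /exc_weight mod0n eqxx; split; ring.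
have inner j : (j < r)%N -> invariant t j.+1 (r * t + j).+1.
  elim: j => [|j IHj] jr; first by rewrite addn0.
  rewrite addnS; apply: invariant_inner (IHj (ltnW jr));
    by rewrite /nonexc_weight /exc_weight -addnS mulnC modnMDl modn_small.
have := inner r.-1; rewrite -addnS prednK // leqnn => /(_ isT) last.
by rewrite mulnSr; apply: invariant_outer last;
  rewrite /nonexc_weight /exc_weight mulnC -mulSnr modnMl.
Qed.

End PeriodicWeights.

(** * Substitutions in power series and the binomial transform *)

Section FpsSubstitutions.
Variable R : comNzRingType.
Implicit Types (f g : fps R) (c : R).

Lemma fps_lreg f : GRing.lreg (f 0%N) -> GRing.lreg f.
Proof.
move=> f0 g h fgh; apply: fpsP => n; have [k] := ubnP n.
elim: k n => // k IHk n nk; apply: f0.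
have := congr1 (fps_nth n) fgh; rewrite /fps_nth !fpsME !big_ord_recl !subn0.
rewrite [X in _ + X](eq_bigr (fun i : 'I_n => f (lift ord0 i) * h (n - lift ord0 i)%N)).
  exact: addIr.
move=> i _; rewrite (IHk (n - lift ord0 i)%N) //=.
by have := ltn_ord i; rewrite /bump /=; lia.
Qed.

Definition fps_scale c f : fps R := FPS (fun n => c ^+ n * f n).

Lemma fps_scaleM c f g : fps_scale c (f * g) = fps_scale c f * fps_scale c g.
Proof.
apply: fpsP => n; rewrite -[LHS]/(c ^+ n * (f * g) n) !fpsME mulr_sumr; apply: eq_bigr => i _.
by rewrite mulrACA -exprD subnKC // -ltnS.
Qed.

Lemma fps_scale1 c : fps_scale c 1 = 1.
Proof.
apply: fpsP => n; rewrite -[LHS]/(c ^+ n * (1 : fps R) n) !fps1E.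
by case: n => [|n]; rewrite ?mulr0 ?mulr1.
Qed.

Lemma fps_scaleX c : fps_scale c fpsX = fpsC c * fpsX.
Proof. by apply: fpsP => -[|[|n]]; rewrite fpsCM /= ?mulr1 ?expr1 ?mulr0. Qed.

Lemma fps_scaleXn c f k : fps_scale c (f ^+ k) = fps_scale c f ^+ k.
Proof. by elim: k => [|k IHk]; rewrite ?fps_scale1 // !exprS fps_scaleM IHk. Qed.

Lemma fps_scaleD c f g : fps_scale c (f + g) = fps_scale c f + fps_scale c g.
Proof. by apply: fpsP => n; rewrite /= -[RHS]mulrDr. Qed.

Lemma fps_scaleN c f : fps_scale c (- f) = - fps_scale c f.
Proof. by apply: fpsP => n; rewrite /= -[RHS]mulrN. Qed.

(** On exponential generating functions this is multiplication by exp (c u); on ordinary ones it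
    sends f(u) to f(u / (1 - c u)) / (1 - c u). *)
Definition binomial_transform c f : fps R :=
  FPS (fun n => \sum_(m < n.+1) (c ^+ m * f (n - m)%N) *+ 'C(n, m)).

Lemma binomial_transformE c f n :
  binomial_transform c f n = \sum_(m < n.+1) (c ^+ m * f (n - m)%N) *+ 'C(n, m).
Proof. by []. Qed.

Lemma binomial_transformD c f g :
  binomial_transform c (f + g) = binomial_transform c f + binomial_transform c g.
Proof.
apply: fpsP => n; rewrite -[RHS]/(_ n + _ n) /= -big_split; apply: eq_bigr => m _ /=.
by rewrite -mulrnDl -mulrDr.
Qed.

Lemma binomial_transformC c b f :
  binomial_transform c (fpsC b * f) = fpsC b * binomial_transform c f.
Proof.
apply: fpsP => n; rewrite fpsCM !binomial_transformE mulr_sumr.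
by apply: eq_bigr => m _; rewrite fpsCM mulrnAr mulrCA.
Qed.

(** Multiplication by u becomes multiplication by u / (1 - c u); on coefficients this is Pascal's
    rule. *)
Lemma binomial_transformX c f :
  (1 - fpsC c * fpsX) * binomial_transform c (fpsX * f) = fpsX * binomial_transform c f.
Proof.
have : forall k, (fpsX * f) k = if k is k'.+1 then f k' else 0 by move=> k; apply: fpsXM.
move: (fpsX * f) => g gE; apply: fpsP => n; rewrite mulrBl mul1r -mulrA.
rewrite -[LHS]/(binomial_transform c g n -
               (fpsC c * (fpsX * binomial_transform c g)) n) fpsCM !fpsXM.
case: n => [|n].
  by rewrite mulr0 subr0 binomial_transformE big_ord1 gE mulr0 mul0rn.
apply/eqP; rewrite subr_eq; apply/eqP; rewrite !binomial_transformE big_ord_recr /=.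
rewrite subnn gE mulr0 mul0rn addr0.
rewrite [X in _ + _ * X]big_ord_recr /= subnn gE mulr0 mul0rn addr0 mulr_sumr.
rewrite [LHS](eq_bigr (fun m : 'I_n.+1 => (c ^+ m * f (n - m)%N) *+ 'C(n.+1, m))); last first.
  by move=> m _; rewrite subSn -1?ltnS // gE.
rewrite !big_ord_recl /= !bin0 -addrA; congr (_ + _).
rewrite -big_split; apply: eq_bigr => m _ /=; rewrite /bump /= !add1n binS mulrnDr.
congr (_ + _); rewrite mulrnAr mulrA -exprS.
by rewrite -[(n - m)%N]subSS subSn ?gE.
Qed.

Lemma binomial_transform1 c : (1 - fpsC c * fpsX) * binomial_transform c 1 = 1.
Proof.
have -> : binomial_transform c 1 = FPS (fun n => c ^+ n).
  apply: fpsP => n; rewrite binomial_transformE big_ord_recr subnn fps1E mulr1 binn mulr1n.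
  rewrite big1 => [|m _]; first exact: add0r.
  rewrite fps1E subn_eq0 /= leqNgt ltn_ord mulr0.
  by rewrite mul0rn.
apply: fpsP => n; rewrite mulrBl mul1r -mulrA.
rewrite -[LHS]/(c ^+ n - (fpsC c * (fpsX * FPS (fun n => c ^+ n))) n) fpsCM fpsXM.
rewrite fps1E; case: n => [|n] /=; first by rewrite mulr0 subr0.
by rewrite exprS subrr.
Qed.

(** Substituting u / (1 - c u) for u turns 1 - b u into (1 - (b + c) u) / (1 - c u). *)
Lemma binomial_transform_lin c b f k :
  (1 - fpsC c * fpsX) ^+ k * binomial_transform c ((1 - fpsC b * fpsX) ^+ k * f) =
  (1 - fpsC (b + c) * fpsX) ^+ k * binomial_transform c f.
Proof.
elim: k f => [|k IHk] f; first by rewrite !expr0 !mul1r.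
rewrite [in LHS]exprSr -mulrA [(1 - fpsC b * fpsX) ^+ k.+1]exprSr.
rewrite -[X in binomial_transform c X]mulrA.
rewrite mulrCA IHk [in RHS]exprSr -mulrA mulrCA; congr (_ * _).
have -> : (1 - fpsC b * fpsX) * f = f + fpsC (- b) * (fpsX * f) by rewrite rmorphN /=; ring.
rewrite binomial_transformD binomial_transformC mulrDr mulrCA binomial_transformX.
rewrite rmorphN rmorphD /=; ring.
Qed.

End FpsSubstitutions.

(** * Negative binomial series *)

Section NegativeBinomial.
Variables (t : nat).

(** For fixed [j] this is the expansion in u of (1 - u)^-(t j + i). The truncated subtraction is
    harmless: the coefficient at [n = 0] is 1 in any case. *)
Definition neg_bin_series (i : nat) : fps (fps rat) :=
  FPS (fun n => FPS (fun j => ('C(t * j + i + n - 1, n))%:R)).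

Lemma neg_bin_seriesS i : (1 - fpsX) * neg_bin_series i.+1 = neg_bin_series i.
Proof.
apply: fpsP => n; rewrite mulrBl mul1r.
rewrite -[LHS]/(neg_bin_series i.+1 n - (fpsX * neg_bin_series i.+1) n) fpsXM.
case: n => [|n].
  by rewrite subr0; apply: fpsP => j; rewrite /= !bin0.
apply: fpsP => j; rewrite -[LHS]/(_ - _) /= !addnS !addSn !subSS !subn0.
by rewrite binS natrD addrK.
Qed.

(** Writing N_i for [neg_bin_series i], shifting [j] by one gives N_0 = 1 + y N_t, while (1 - u)^t
    N_t = N_0. *)
Lemma neg_bin_series_rec :
  (1 - fpsX) ^+ t * neg_bin_series 0 = fpsC fpsX * neg_bin_series 0 + (1 - fpsX) ^+ t.
Proof.
have pow k : (1 - fpsX) ^+ k * neg_bin_series k = neg_bin_series 0.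
  elim: k => [|k IHk]; first by rewrite mul1r.
  by rewrite exprSr -mulrA neg_bin_seriesS.
have {1}-> : neg_bin_series 0 = fpsC fpsX * neg_bin_series t + 1.
  apply: fpsP => n; apply: fpsP => j.
  rewrite -[RHS]/((fpsC fpsX * neg_bin_series t) n j + (1 : fps (fps rat)) n j).
  rewrite fpsCM fpsXM fps1E fpsMnE fps1E /=.
  case: j => [|j].
    rewrite muln0 !add0n add0r; case: n => [|n]; first by rewrite bin0.
    by rewrite subSS subn0 bin_small.
  rewrite mul0rn addr0 mulnS addn0 [(t + _)%N]addnC //.
by rewrite mulrDr mulr1 mulrCA pow.
Qed.

End NegativeBinomial.

Lemma fps_torsion_free (R : comNzRingType) :
  (forall k (x : R), x *+ k.+1 = 0 -> x = 0) ->
  forall k (f : fps R), f *+ k.+1 = 0 -> f = 0.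
Proof.
move=> tf k f fk; apply: fpsP => n; rewrite -[RHS]/(fps_nth n 0) raddf0; apply: (tf k).
by rewrite -fpsMnE fk -[LHS]/(fps_nth n 0) raddf0.
Qed.

Lemma rat_torsion_free k (x : rat) : x *+ k.+1 = 0 -> x = 0.
Proof. by move/eqP; rewrite mulrn_eq0 => /eqP. Qed.

Lemma eq_step_det (R : comNzRingType) (v w : nat -> R) k :
  v =1 w -> step_det v k = step_det w k.
Proof. by move=> /funext ->. Qed.

(** * The identity at a fixed level *)

Section LevelIdentity.
Variables (r t : nat).
Hypothesis r_gt0 : (0 < r)%N.
Local Notation y := (fpsX : fps rat).
Local Notation Y := ((fpsX : fps rat) ^+ r).

(** The generating function in [y] of the Ehrhart polynomials of the half-open
    slices, evaluated at [t]. *)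
Definition slice_gf n : fps rat := (1 - y) * (1 - Y) ^+ n * neg_bin_series t 0 n.

Definition exc_gf n : fps rat :=
  exc_sum (nonexc_weight r y) (exc_weight r y) (r * t).+1 n.

Lemma fps_lreg1 (R : comNzRingType) (f : fps R) : f 0%N = 1 -> GRing.lreg f.
Proof. by move=> f0; apply: fps_lreg; rewrite f0; apply: lreg1. Qed.

Lemma fps0M (R : comNzRingType) (f g : fps R) : (f * g) 0%N = f 0%N * g 0%N.
Proof. by rewrite fpsME big_ord1. Qed.

Lemma fps0X (R : comNzRingType) (f : fps R) k : (f ^+ k) 0%N = f 0%N ^+ k.
Proof. by elim: k => [|k IHk]; rewrite ?fps1E // !exprS fps0M IHk. Qed.

Let const1 (R : comNzRingType) (f : fps R) c :
  (1 - fpsX * f) 0%N = 1 /\ (1 - c * fpsX : fps R) 0%N = 1.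
Proof.
by rewrite !fpsBE !fps1E !fps0M /= mul0r mulr0 !subr0.
Qed.

Let lreg_Q : GRing.lreg ((1 - fpsC Y * fpsX) *
   ((1 - fpsX) ^+ t - fpsC y * (1 - fpsC Y * fpsX) ^+ t) : fps (fps rat)).
Proof.
apply: fps_lreg; rewrite fps0M (const1 0 (fpsC Y)).2 mul1r.
rewrite fpsBE fps0M !fps0X (const1 0 (fpsC Y)).2 -[X in 1 - X](mul1r fpsX) (const1 0 1).2.
rewrite !expr1n mulr1; apply: fps_lreg1.
by rewrite fpsBE fps1E subr0.
Qed.

(** The excedance series meets the determinant at [(r * t).+1] letters; the common factors have
    constant coefficient 1 and cancel. *)
Lemma exc_gf_series :
  FPS exc_gf * ((1 - fpsC Y * fpsX) * ((1 - fpsX) ^+ t - fpsC y * (1 - fpsC Y * fpsX) ^+ t)) =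
  (1 - fpsC y) * (1 - fpsX) ^+ t.
Proof.
pose K := (r * t).+1; pose Y' : fps (fps rat) := fpsC y.
have := @exc_series _ (nonexc_weight r y) (exc_weight r y) K
          (fps_torsion_free rat_torsion_free).
have wE a : fpsX * fpsC (signed_weight (nonexc_weight r y) (exc_weight r y) a) =
    fpsX * signed_weight (nonexc_weight r Y') (exc_weight r Y') a.
  congr (_ * _); rewrite /signed_weight /nonexc_weight /exc_weight /Y'.
  by case: ifP => _; rewrite ?(fun_if (@fpsC _)) ?(fun_if fpsC) !rmorphXn.
rewrite (eq_step_det _ wE).
rewrite (eq_bigr (fun i : 'I_K => 1 - fpsX * exc_weight r Y' i)) => [|i _]; last first.
  by rewrite /exc_weight rmorphXn.
set q := \prod_(i < K) _ => FD.
have lreg_q : GRing.lreg q.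
  apply: fps_lreg1; rewrite /q; elim: {FD q} K => [|k IHk]; first by rewrite big_ord0 fps1E.
  by rewrite big_ord_recr [LHS]fps0M IHk (const1 _ 0).1 mulr1.
have lreg_X : GRing.lreg (1 - fpsX : fps (fps rat)).
  by apply: fps_lreg1; rewrite -[X in 1 - X](mul1r fpsX) (const1 0 1).2.
have := step_det_period r_gt0 (fpsX : fps (fps rat)) Y' t.
rewrite -/K -/q; move: (step_det _ K) FD => d FD E.
apply: lreg_q; apply: lreg_X; rewrite -FD; move: E; rewrite -FD.
rewrite -!rmorphXn /= -!/Y' => E.
transitivity (FPS exc_gf * (FPS exc_gf * d * ((1 - fpsC Y * fpsX) *
   ((1 - fpsX) ^+ t - Y' * (1 - fpsC Y * fpsX) ^+ t)) * (1 - fpsX))).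
  by rewrite /exc_gf -/K; ring.
by rewrite -E /exc_gf -/K; ring.
Qed.

(** The slice series A satisfies P^t A = y A + (1 - y) P^t with P = 1 - (1 - Y) u. The binomial
    transform at [Y] turns P into (1 - u) / (1 - Y u), which yields the equation of
    [exc_gf_series]. *)
Lemma exc_gf_slices n :
  exc_gf n = \sum_(m < n.+1) (Y ^+ m * slice_gf (n - m)) *+ 'C(n, m).
Proof.
suff : FPS exc_gf = binomial_transform Y (FPS slice_gf) by move/(congr1 (fps_nth n)).
pose A : fps (fps rat) := FPS slice_gf; pose P : fps (fps rat) := 1 - fpsC (1 - Y) * fpsX.
have AE : A = fpsC (1 - y) * fps_scale (1 - Y) (neg_bin_series t 0).
  by apply: fpsP => k; rewrite fpsCM /= mulrA.
have A_rec : P ^+ t * A = fpsC y * A + fpsC (1 - y) * P ^+ t.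
  have -> : P ^+ t = fps_scale (1 - Y) ((1 - fpsX) ^+ t).
    by rewrite fps_scaleXn fps_scaleD fps_scaleN fps_scale1 fps_scaleX.
  rewrite AE mulrCA -fps_scaleM neg_bin_series_rec fps_scaleD fps_scaleM.
  have -> : fps_scale (1 - Y) (fpsC y) = fpsC y.
    by apply: fpsP => -[|k]; rewrite /= ?mulr0 ?mul1r.
  by ring.
have lin f : (1 - fpsC Y * fpsX) ^+ t * binomial_transform Y (P ^+ t * f) =
             (1 - fpsX) ^+ t * binomial_transform Y f.
  by rewrite binomial_transform_lin subrK rmorph1 mul1r.
have := congr1 (fun f => (1 - fpsC Y * fpsX) ^+ t * binomial_transform Y f) A_rec.
rewrite /= -[X in fpsC (1 - y) * X]mulr1 lin binomial_transformD !binomial_transformC.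
rewrite mulrDr [X in _ = _ + X]mulrCA lin => E.
have E1 := binomial_transform1 Y.
apply: lreg_Q; rewrite mulrC exc_gf_series -/A; apply/esym.
transitivity ((1 - fpsC Y * fpsX) * ((1 - fpsX) ^+ t * binomial_transform Y A
   - (1 - fpsC Y * fpsX) ^+ t * (fpsC y * binomial_transform Y A))); first by ring.
rewrite E rmorphB rmorph1.
transitivity ((1 - fpsC y) * (1 - fpsX) ^+ t *
  ((1 - fpsC Y * fpsX) * binomial_transform Y 1)); first by ring.
by rewrite E1 mulr1.
Qed.

End LevelIdentity.

(** * Colored permutations *)

Section Chains.

(** The number of sequences [t >= a_0 >= ... >= a_(n-1) >= 0] in which the step
    down to [a_i] is at least [b i]. *)
Fixpoint chain_count n : ('I_n -> nat) -> nat -> nat :=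
  match n with
  | 0 => fun _ _ => 1%N
  | n'.+1 => fun b t => (\sum_(a < t.+1 - b ord0) chain_count (b \o lift ord0) a)%N
  end.

(** Each term of a chain contributes a summation, hence a factor 1 / (1 - z), and a shift by its
    required step; the extra factor is that of the empty chain, counted once for every [t]. *)
Lemma chain_count_series (R : comNzRingType) n (b : 'I_n -> nat) :
  (1 - fpsX) ^+ n.+1 * FPS (fun t => (chain_count b t)%:R) =
  fpsX ^+ (\sum_i b i)%N :> fps R.
Proof.
elim: n b => [|n IHn] b.
  rewrite big_ord0 expr0 expr1; apply: fpsP => t; rewrite mulrBl mul1r fpsBE fpsXM fps1E.
  by case: t => [|t]; rewrite /= ?subr0 ?subrr.
rewrite exprSr -mulrA.
have -> : (1 - fpsX) * FPS (fun t => (chain_count b t)%:R) =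
    fpsX ^+ b ord0 * FPS (fun t => (chain_count (b \o lift ord0) t)%:R) :> fps R.
  apply: fpsP => t; rewrite mulrBl mul1r fpsBE fpsXM fpsXnM.
  case: t => [|t] /=.
    rewrite leqn0; case: (b ord0) => [|b0] /=; first by rewrite subn0 big_ord1 subr0.
    by rewrite subSS sub0n big_ord0 subr0.
  case: (leqP (b ord0) t.+1) => [bt|tb].
    by rewrite [(t.+2 - _)%N]subSn // big_ord_recr /= natrD addrC addKr.
  have [-> ->] : (t.+2 - b ord0 = 0 /\ t.+1 - b ord0 = 0)%N by split; lia.
  by rewrite !big_ord0 subrr.
by rewrite mulrCA IHn -exprD big_ord_recl.
Qed.

(** The bound [T] is kept apart from [t] so that [t] can vary in an induction on [n]. *)
Definition is_chain n T (b : 'I_n -> nat) (t : nat) (a : {ffun 'I_n -> 'I_T}) : bool :=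
  [forall i : 'I_n, (i == 0 :> nat)%N ==> (a i + b i <= t)%N] &&
  [forall i : 'I_n, forall j : 'I_n, (j == i.+1 :> nat) ==> (a j + b j <= a i)%N].

Lemma card_is_chain n T (b : 'I_n -> nat) t : (t < T)%N ->
  #|[set a : {ffun 'I_n -> 'I_T} | is_chain b t a]| = chain_count b t.
Proof.
elim: n b t => [|n IHn] b t tT.
  rewrite (eq_card (B := predT)) ?card_ffun ?card_ord ?expn0 // => a.
  by rewrite !inE; apply/andP; split; apply/forallP => -[].
have cons0 (a0 : 'I_T) (a : {ffun 'I_n -> 'I_T}) :
    is_chain b t (insert_letter ord0 a0 a) =
    (a0 + b ord0 <= t)%N && is_chain (b \o lift ord0) a0 a.
  apply/andP/andP => [[/forallP h0 /'forall_forallP hS]|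
    [h0 /andP[/forallP h1 /'forall_forallP hS]]]; split.
  - by have := h0 ord0; rewrite insert_letter_at.
  - apply/andP; split.
      apply/forallP => i; apply/implyP => /eqP i0.
      have := hS ord0 (lift ord0 i); rewrite insert_letter_lift insert_letter_at /=.
      by rewrite /bump /= i0.
    apply/'forall_forallP => i j; apply/implyP => /eqP ij.
    have := hS (lift ord0 i) (lift ord0 j); rewrite !insert_letter_lift /=.
    by rewrite /bump /= ij !add1n eqxx.
  - apply/forallP => i; apply/implyP => /eqP i0.
    by rewrite (_ : i = ord0) ?insert_letter_at //; apply: val_inj.
  apply/'forall_forallP => i j; apply/implyP => /eqP ij.
  case: (unliftP ord0 j) ij => [j' ->|-> //] ij.
  case: (unliftP ord0 i) ij => [i' ->|->] ij.
    rewrite !insert_letter_lift; have /implyP := hS i' j'; apply.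
    by move: ij; rewrite /= /bump /= !add1n => -[->].
  rewrite insert_letter_lift insert_letter_at; have /implyP := h1 j'; apply.
  by move: ij; rewrite /= /bump /= !add1n => -[->].
rewrite /= -sum1_card (reindex _ (onW_bij _ (ffun_cons_bij ord0 'I_T))) /=.
rewrite (eq_bigl (fun p : 'I_T * {ffun 'I_n -> 'I_T} => (p.1 + b ord0 <= t)%N &&
    is_chain (b \o lift ord0) p.1 p.2)); last first.
  by move=> [a0 a]; rewrite inE /= -/(insert_letter ord0 a0 a) cons0.
rewrite -(pair_big_dep (fun a0 : 'I_T => a0 + b ord0 <= t)%N
  (fun a0 a => is_chain (b \o lift ord0) a0 a) (fun _ _ => 1%N)) /=.
have le_T : (t.+1 - b ord0 <= T)%N by rewrite (leq_trans _ tT) ?leq_subr.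
rewrite (eq_bigl (fun a0 : 'I_T => (a0 < t.+1 - b ord0)%N)); last first.
  by move=> a0; lia.
rewrite (big_ord_narrow le_T); apply: eq_bigr => a0 _ /=.
rewrite -(IHn _ a0); last by rewrite (leq_trans (ltn_ord a0)).
by rewrite -sum1_card; apply: eq_bigl => a; rewrite inE.
Qed.

End Chains.

Section LexAdjacent.
Local Open Scope nat_scope.
Variables (n N : nat) (l : {ffun 'I_n -> 'I_N}) (s : 'S_n).

Lemma lex_sorted_adjacent :
  lex_sorted l s = [forall i : 'I_n, forall j : 'I_n, (j == i.+1 :> nat) ==> lexlt l s i j].
Proof.
apply/'forall_forallP/'forall_forallP => h i j; apply/implyP.
  by move=> /eqP ij; have /implyP := h i j; apply; rewrite ij.
case: j => j jn /=; elim: j jn => // j IHj jn.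
rewrite ltnS leq_eqVlt => /orP[/eqP ij|ij].
  by have /implyP := h i (Ordinal jn); apply; rewrite /= ij.
have jn' := ltnW jn; have := IHj jn' ij.
have /implyP/(_ (eqxx _)) := h (Ordinal jn') (Ordinal jn).
rewrite /lexlt -!val_eqE /=; lia.
Qed.

End LexAdjacent.

(** * Colored permutations as words *)

Section ColoredWords.
Variables (r n : nat).
Hypothesis r_gt0 : (0 < r)%N.
Implicit Type w : colperm r n.

Definition colored_drop w (i j : 'I_n) : bool :=
  ((w.2 i < w.2 j) || ((w.2 i == w.2 j) && (w.1 j < w.1 i)))%N.

(** A positive first color counts as a drop at position 0, which accounts for
    the rounding up in [ceil_div (fdes_star w) r]. *)
Definition drop_flag w (j : 'I_n) : nat :=
  (((j == 0 :> nat) && (0 < w.2 j)) +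
   \sum_(i < n) ((j == i.+1 :> nat) && colored_drop w i j))%N.

Lemma sum_drop_flag w : (\sum_j drop_flag w j)%N = ceil_div (fdes_star w) r.
Proof.
pose c0 := (\sum_(i < n | i == 0 :> nat) w.2 i)%N.
have c0r : (c0 < r)%N.
  rewrite /c0; case: (posnP n) => [n0|n_gt0].
    by rewrite big1 // => i; have := ltn_ord i; rewrite {2}n0.
  by rewrite (big_pred1 (Ordinal n_gt0)).
have -> : (\sum_j drop_flag w j = des_star w + (0 < c0))%N.
  rewrite big_split /= addnC exchange_big /=; congr addn.
    rewrite /des_star -sum1_card [RHS]big_mkcond; apply: eq_bigr => i _.
    rewrite inE; case: existsP => [[j /andP[/eqP ij dj]]|nex].
      rewrite (bigD1 j) //= ij eqxx /= /colored_drop dj big1 // => k kj.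
      by rewrite -ij val_eqE (negPf kj).
    rewrite big1 // => j _; case: eqP => //= ij.
    case dj: colored_drop => //; case: nex; exists j; rewrite ij eqxx.
    exact: dj.
  rewrite /c0; case: (posnP n) => [n0|n_gt0].
    rewrite !big1 // => i; first by move=> _; have := ltn_ord i; rewrite {2}n0.
    by have := ltn_ord i; rewrite {2}n0.
  rewrite (bigD1 (Ordinal n_gt0)) //= [in RHS](big_pred1 (Ordinal n_gt0)) // big1 ?addn0 //.
  by move=> i; rewrite -val_eqE /= => /negPf ->.
rewrite /ceil_div /fdes_star -/c0.
have r0 : 0 < r%:R :> rat by rewrite ltr0n.
rewrite natrD natrM mulrDl mulrAC mulfV ?gt_eqF // mul1r.
rewrite [Num.ceil _](_ : _ = (des_star w + (0 < c0))%N%:Z) //.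
apply: ceil_def; case: (posnP c0) => [->|c0_gt0].
  rewrite mul0r addn0 addr0 rmorphB /= !rmorph1 lexx andbT.
  by rewrite ltrBlDr ltrDl ltr01.
rewrite addn1 -addn1 PoszD addrK rmorphD /= rmorph1 ltrDl lerD2l.
rewrite divr_gt0 ?ltr0n //= ler_pdivrMr // mul1r ler_nat.
exact: ltnW.
Qed.

(** Pairs (level, color) are encoded by one letter. When the levels decrease
    along the positions, strictly where [drop_flag] is 1, the letters increase
    and equal letters carry increasing values of the permutation. *)
Definition colored_letter t (c : 'I_r) (a : 'I_t.+1) : 'I_(r * t).+1 :=
  inord (r * t - (r * a + c)).

Definition colored_word t (p : {ffun 'I_n -> 'I_r} * {ffun 'I_n -> 'I_t.+1}) :
    {ffun 'I_n -> 'I_(r * t).+1} :=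
  [ffun i => colored_letter (p.1 i) (p.2 i)].

Lemma colored_wordE t p i :
  @colored_word t p i = (r * t - (r * p.2 i + p.1 i))%N :> nat.
Proof. by rewrite ffunE /colored_letter inordK // ltnS leq_subr. Qed.

Lemma drop_flagS w (i j : 'I_n) : j = i.+1 :> nat ->
  drop_flag w j = colored_drop w i j.
Proof.
move=> ij; rewrite /drop_flag ij /= add0n (bigD1 i) //= eqxx big1 ?addn0 // => k ki.
by rewrite eqSS [(i == k :> nat)]eq_sym val_eqE (negPf ki).
Qed.

(** The inequality keeps the subtraction in [colored_letter] from truncating. At position 0 it is
    the chain condition; it then passes from each position to the next, where a required drop in
    level matches [lexlt] on letters. *)
Lemma is_chain_lex_sorted t w (a : {ffun 'I_n -> 'I_t.+1}) :
  is_chain (drop_flag w) t a =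
  [forall i : 'I_n, (r * a i + w.2 i <= r * t)%N] && lex_sorted (colored_word (w.2, a)) w.1.
Proof.
have flag0 (i : 'I_n) : i = 0%N :> nat -> drop_flag w i = (0 < w.2 i)%N.
  by move=> i0; rewrite /drop_flag i0 eqxx big1 // addn0.
have first (i : 'I_n) : i = 0%N :> nat ->
    (a i + drop_flag w i <= t)%N = (r * a i + w.2 i <= r * t)%N.
  move=> i0; rewrite flag0 //; have := ltn_ord (w.2 i); case: (posnP (w.2 i)) => [->|c0] cr.
    by rewrite !addn0 leq_pmul2l.
  rewrite addn1; apply/idP/idP => h; first by nia.
  by rewrite ltnNge; apply/negP => h'; nia.
have next (i j : 'I_n) : j = i.+1 :> nat ->
    (r * a i + w.2 i <= r * t)%N ->
    (a j + drop_flag w j <= a i)%N =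
    (r * a j + w.2 j <= r * t)%N && lexlt (colored_word (w.2, a)) w.1 i j.
  move=> ij hi; rewrite (drop_flagS w ij) /lexlt -val_eqE /= !colored_wordE /=.
  have := ltn_ord (w.2 i); have := ltn_ord (w.2 j); rewrite /colored_drop.
  have : (w.1 i == w.1 j :> nat) = false.
    apply/negbTE/eqP => /val_inj/perm_inj E; move: ij; rewrite E.
    by move/esym/eqP; rewrite gtn_eqF.
  move: (nat_of_ord (w.1 i)) (nat_of_ord (w.1 j)) => si sj.
  rewrite -!val_eqE /=.
  move: (nat_of_ord (w.2 i)) (nat_of_ord (w.2 j)) hi => ci cj.
  move: (nat_of_ord (a i)) (nat_of_ord (a j)) => ai aj hi sij crj cri.
  case: (ltngtP ai aj) => aij.
  - have : (r * ai + ci < r * aj)%N by nia.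
    case: (_ || _); lia.
  - have : (r * aj + cj < r * ai)%N by nia.
    by case: (_ || _); lia.
  - rewrite aij; case: (ltngtP ci cj); case: (ltngtP si sj) sij => //=; lia.
rewrite lex_sorted_adjacent.
apply/andP/andP => [[/forallP c0 /'forall_forallP cS]|[/forallP le /'forall_forallP adj]]; split.
- apply/forallP => -[k kn]; elim: k kn => [|k IHk] kn.
    by rewrite -first //; apply: (implyP (c0 _)).
  have := implyP (cS (Ordinal (ltnW kn)) (Ordinal kn)) (eqxx _).
  by rewrite next ?IHk // => /andP[].
- have le : forall i : 'I_n, (r * a i + w.2 i <= r * t)%N.
    move=> [k kn]; elim: k kn => [|k IHk] kn.
      by rewrite -first //; apply: (implyP (c0 _)).
    have := implyP (cS (Ordinal (ltnW kn)) (Ordinal kn)) (eqxx _).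
    by rewrite next ?IHk // => /andP[].
  apply/'forall_forallP => i j; apply/implyP => /eqP ij.
  by have := implyP (cS i j); rewrite ij eqxx next ?le //= => /(_ isT).
- by apply/forallP => i; apply/implyP => /eqP i0; rewrite first.
apply/'forall_forallP => i j; apply/implyP => /eqP ij.
by rewrite next ?le //=; apply: (implyP (adj i j)); rewrite ij.
Qed.

Local Notation y := (fpsX : fps rat).

Lemma colored_weight t w (a : {ffun 'I_n -> 'I_t.+1}) :
  [forall i : 'I_n, (r * a i + w.2 i <= r * t)%N] ->
  \prod_(i < n) (if (i < w.1 i)%N then exc_weight r y (colored_word (w.2, a) i)
           else nonexc_weight r y (colored_word (w.2, a) i)) = y ^+ (r * n - fexc w).
Proof.
move=> /forallP le.
pose e (i : 'I_n) := (r - (r * ((i < w.1 i)%N && (w.2 i == 0 :> nat)) + w.2 i))%N.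
have e_le (i : 'I_n) : (r * ((i < w.1 i)%N && (w.2 i == 0 :> nat)) + w.2 i <= r)%N.
  have cr := ltn_ord (w.2 i); case: (posnP (w.2 i)) => [->|c0] /=.
    by rewrite andbT addn0 -[X in (_ <= X)%N]muln1 leq_mul2l leq_b1 orbT.
  by rewrite andbF muln0 ltnW.
rewrite (eq_bigr (fun i => y ^+ e i)) => [|i _].
  rewrite prodrXr; congr (_ ^+ _); apply/esym/eqP.
  have : (\sum_i e i + fexc w = r * n)%N.
    have -> : fexc w = (\sum_(i < n)
        (r * ((i < w.1 i) && (w.2 i == 0 :> nat)) + w.2 i))%N.
      rewrite /fexc big_split /= -sum1_card big_distrr [in LHS]big_mkcond /=.
      congr addn; apply: eq_bigr => i _; rewrite inE.
      by case: (_ && _); rewrite ?muln1 ?muln0.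
    rewrite -big_split (eq_bigr (fun=> r)) => [|i _ /=]; last by rewrite subnK.
    by rewrite sum_nat_const card_ord mulnC.
  by move=> <-; rewrite addnK.
have cr := ltn_ord (w.2 i); rewrite /exc_weight /nonexc_weight colored_wordE /=.
have -> : ((r * t - (r * a i + w.2 i)) %% r = if w.2 i == 0%N :> nat then 0 else r - w.2 i)%N.
  have := le i; case: (posnP (w.2 i)) => [->|c0] lei.
    by rewrite addn0 -mulnBr mulnC modnMl.
  have at_ : (a i < t)%N by nia.
  have -> : (r * t - (r * a i + w.2 i) = (t - a i).-1 * r + (r - w.2 i))%N by nia.
  by rewrite modnMDl modn_small // ltn_subrL c0.
rewrite /e; case: (posnP (w.2 i)) => [->|c0] /=.
  by rewrite andbT; case: (_ < _)%N; rewrite ?muln1 ?muln0 ?addn0 ?subnn ?subn0.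
by rewrite andbF muln0 add0n subn_eq0 (leqNgt r) cr /= if_same.
Qed.

Definition colored_unword t (l : {ffun 'I_n -> 'I_(r * t).+1}) :
    {ffun 'I_n -> 'I_r} * {ffun 'I_n -> 'I_t.+1} :=
  ([ffun i => Ordinal (ltn_pmod (r * t - l i) r_gt0)],
   [ffun i => inord ((r * t - l i) %/ r)]).

Let level_lt t k : ((r * t - k) %/ r < t.+1)%N.
Proof. by rewrite ltnS -[X in (_ <= X)%N](mulKn t r_gt0) leq_div2r ?leq_subr. Qed.

Lemma colored_unwordK t : cancel (@colored_unword t) (@colored_word t).
Proof.
move=> l; apply/ffunP => i; apply: val_inj; rewrite /= colored_wordE /= !ffunE /=.
rewrite inordK // [(r * (_ %/ r))%N]mulnC -divn_eq subKn //.
by rewrite -ltnS ltn_ord.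
Qed.

(** Decoding is Euclidean division, so it recovers exactly the pairs whose encoding does not
    truncate; these index the words in the reindexing below. *)
Lemma colored_wordK t (c : {ffun 'I_n -> 'I_r}) (a : {ffun 'I_n -> 'I_t.+1}) :
  (colored_unword (colored_word (c, a)) == (c, a)) =
  [forall i : 'I_n, (r * a i + c i <= r * t)%N].
Proof.
apply/eqP/forallP => [[Ec Ea] i|le].
  have [/ffunP/(_ i)/(congr1 val) /= ci /ffunP/(_ i)/(congr1 val) /= ai] := (Ec, Ea).
  rewrite -ci -ai !ffunE /= inordK // [(r * (_ %/ r))%N]mulnC -divn_eq.
  exact: leq_subr.
congr (_, _); apply/ffunP => i; apply: val_inj; rewrite ffunE /= ?inordK //;
  rewrite colored_wordE /= subKn // mulnC ?modnMDl ?modn_small //.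
by rewrite divnMDl // divn_small // addn0.
Qed.

Lemma exc_gf_colored t :
  exc_gf r t n = \sum_(w : colperm r n) y ^+ (r * n - fexc w) *+ chain_count (drop_flag w) t.
Proof.
rewrite /exc_gf /exc_sum.
transitivity (\sum_(s : 'S_n) \sum_(c : {ffun 'I_n -> 'I_r})
    \sum_(a : {ffun 'I_n -> 'I_t.+1} | is_chain (drop_flag (s, c)) t a)
       y ^+ (r * n - fexc (s, c))).
  apply: eq_bigr => s _.
  rewrite (reindex_onto (@colored_word t)
    (@colored_unword t)) /=; last by move=> l _; apply: colored_unwordK.
  rewrite pair_big_dep /=; apply: eq_big => [[c a]|[c a]] /=.
    rewrite (is_chain_lex_sorted (s, c)) /= andbC; congr (_ && _).
    exact: colored_wordK.
  move=> /andP[_ /eqP E].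
  by rewrite (@colored_weight t (s, c)) //; rewrite -colored_wordK E.
rewrite pair_big /=; apply: eq_bigr => -[s c] _.
rewrite sumr_const -(@card_is_chain _ t.+1) //; congr (_ *+ _).
by apply: eq_card => a; rewrite !inE.
Qed.

End ColoredWords.

(** Reads a sequence of series in [y], indexed by exponents of [z], as a series
    in [y] with coefficients in [Q[[z]]]. *)
Definition level_series (phi : nat -> fps rat) : fps_yz :=
  FPS (fun k => FPS (fun t => phi t k)).

(** * The generating function of colored permutations *)

Section ColoredSide.
Variables (r n : nat).
Hypothesis r_gt0 : (0 < r)%N.

(** Each position contributes at most [r], and the last one, never an excedance, only its color.
    Hence [r * n - fexc w] is positive and avoids the convention at [k = 0]. *)
Lemma fexc_lt (w : colperm r n) : (0 < n)%N -> (fexc w < r * n)%N.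
Proof.
case: n w => // m w _.
have -> : fexc w = (\sum_(i < m.+1)
    (r * ((i < w.1 i) && (w.2 i == 0 :> nat)) + w.2 i))%N.
  rewrite /fexc big_split /= -sum1_card big_distrr [in LHS]big_mkcond /=.
  congr addn; apply: eq_bigr => i _; rewrite inE.
  by case: (_ && _); rewrite ?muln1 ?muln0.
rewrite big_ord_recr /= mulnSr -addnS leq_add //; last first.
  have -> : (m < w.1 ord_max)%N = false by rewrite ltnNge -ltnS ltn_ord.
  by rewrite muln0 add0n.
rewrite mulnC -[m in (m * r)%N]card_ord -sum_nat_const leq_sum // => i _.
have cr := ltn_ord (w.2 (widen_ord (leqnSn m) i)).
case: (posnP (w.2 _)) => [->|c0] /=.
  by rewrite andbT addn0 -[X in (_ <= X)%N]muln1 leq_mul2l leq_b1 orbT.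
by rewrite andbF muln0 ltnW.
Qed.

Lemma C_coef_sum :
  \sum_(k < (r * n).+1) fpsC (C_coef r n k) * fpsX ^+ k =
  \sum_(w : colperm r n) fpsC (fpsX ^+ ceil_div (fdes_star w) r) * fpsX ^+ (r * n - fexc w)
  :> fps_yz.
Proof.
case: (posnP n) => [n0|n_gt0].
  have w_unique : forall w w' : colperm r n, w = w'.
    move=> [s c] [s' c']; congr (_, _); [apply/permP | apply/ffunP] => i;
      by have := ltn_ord i; rewrite {2}n0.
  pose w0 : colperm r n := (1%g, [ffun=> Ordinal r_gt0]).
  rewrite (big_pred1 w0) => [|w]; last by apply/esym/eqP; apply: w_unique.
  rewrite big_ord_recl [X in _ + X]big1 => [|k _]; last first.
    by exfalso; have := ltn_ord k; move/eqP: n0; nia.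
  have des0 : fdes_star w0 = 0%N.
    rewrite /fdes_star /des_star big1 ?addn0; last first.
      by move=> i; have := ltn_ord i; rewrite {2}n0.
    rewrite [#|_|](_ : _ = 0%N) ?muln0 //; apply/eqP; rewrite cards_eq0.
    by apply/eqP/setP => i; have := ltn_ord i; rewrite {2}n0.
  have rn0 : (r * n - fexc w0 = 0)%N by rewrite {1}n0 muln0.
  by rewrite rn0 des0 /C_coef n0 /ceil_div mul0r ceil0 !expr0 addr0.
rewrite big_ord_recl {1}/C_coef /= gtn_eqF // rmorph0 mul0r add0r.
under eq_bigr => k _ do rewrite /C_coef /= rmorph_sum mulr_suml.
rewrite (exchange_big_dep predT) //=; apply: eq_bigr => w _.
have lt_w := fexc_lt w n_gt0.
have k_lt : ((r * n - fexc w).-1 < r * n)%N by lia.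
rewrite (big_pred1 (Ordinal k_lt)) => [|k /=]; last first.
  by rewrite -val_eqE /= /bump /=; have := ltn_ord k; lia.
by rewrite /= /bump /= add1n prednK ?subn_gt0.
Qed.

Lemma C_gf :
  \sum_(k < (r * n).+1) fpsC (C_coef r n k) * fpsX ^+ k =
  (1 - fpsC fpsX) ^+ n.+1 * level_series (fun t => exc_gf r t n).
Proof.
have -> : level_series (fun t => exc_gf r t n) = \sum_(w : colperm r n)
    fpsC (FPS (fun t => (chain_count (drop_flag w) t)%:R)) * fpsX ^+ (r * n - fexc w).
  apply: fpsP => k; apply: fpsP => t; rewrite /= exc_gf_colored // !fps_sumE.
  apply: eq_bigr => w _; rewrite fpsCM fpsXnE fpsMnE fpsXnE mulr_natr fpsMnE /=.
  by case: eqP; rewrite ?mul0rn ?mulr0n ?mulr1n.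
rewrite C_coef_sum mulr_sumr; apply: eq_bigr => w _.
rewrite mulrA -(rmorph1 (@fpsC _)) -rmorphB -rmorphXn -rmorphM /=.
by rewrite chain_count_series sum_drop_flag.
Qed.

End ColoredSide.

(** * Ehrhart series of slices *)

Section LatticePoints.
Variables (R : realType) (n r k t : nat).
Hypotheses (k_gt0 : (0 < k)%N) (t_gt0 : (0 < t)%N).

Definition slice_point : pred {ffun 'I_n -> 'I_(r * t)} := fun f =>
  (t * k.-1 <= \sum_(i < n) f i < t * k)%N.

Let point (f : {ffun 'I_n -> 'I_(r * t)}) : 'rV[R]_n := \row_i (f i)%:R.

Let point_inj : injective point.
Proof.
move=> f g /rowP E; apply/ffunP => i; apply: val_inj => /=.
by have := E i; rewrite !mxE => /eqP; rewrite eqr_nat => /eqP.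
Qed.

Lemma lattice_count_slice :
  lattice_count (@slice R n r k) t = #|[pred f | slice_point f]|.
Proof.
have t0 : 0 < t%:R :> R by rewrite ltr0n.
have tN : t%:R != 0 :> R by rewrite gt_eqF.
have kE : k%:R - 1 = k.-1%:R :> R by rewrite -[k in LHS]prednK // -addn1 natrD addrK.
rewrite /lattice_count.
rewrite [X in fset_set X](_ : _ = [set` (point @` [fset f in slice_point])%fset]%classic); last first.
  apply/seteqP; split => w /=.
    move=> [[v [v_bd]] + <-]; rewrite kE => /andP[lo hi] /mxOverP int_tv.
    have tv_nat i : t%:R * v 0 i \is a Num.nat.
      have := int_tv 0 i; rewrite mxE natrEint => ->.
      by rewrite mulr_ge0 ?ler0n //; case/andP: (v_bd i).
    have lt (i : 'I_n) : (Num.truncn (t%:R * v 0%R i)%R < r * t)%N.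
      rewrite -(ltr_nat R) (truncnK (tv_nat i)) mulnC natrM ltr_pM2l //.
      by case/andP: (v_bd i).
    apply/imfsetP; exists [ffun i => Ordinal (lt i)] => /=; last first.
      by apply/rowP => i; rewrite !mxE ffunE /= truncnK.
    rewrite inE unfold_in /slice_point -(ltr_nat R) -(ler_nat R) natr_sum.
    rewrite (eq_bigr (fun i => t%:R * v 0 i)) => [|i _]; last by rewrite ffunE /= truncnK.
    by rewrite -mulr_sumr !natrM ler_pM2l // ltr_pM2l // lo.
  case/imfsetP => f /=; rewrite inE => Pf ->; split.
    exists (t%:R^-1 *: point f); last by rewrite scalerA divff // scale1r.
    split=> [i|].
      rewrite !mxE mulr_ge0 ?invr_ge0 ?ler0n //= mulrC ltr_pdivrMr // -natrM ltr_nat.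
      exact: ltn_ord.
    rewrite (eq_bigr (fun i => t%:R^-1 * (f i)%:R)) => [|i _]; last by rewrite !mxE.
    rewrite -mulr_sumr -natr_sum kE mulrC ler_pdivlMr // ltr_pdivrMr //.
    by rewrite -!natrM ler_nat ltr_nat mulnC [(k * t)%N]mulnC.
  by apply/mxOverP => i j; rewrite !mxE; apply: intr_nat; apply: natr_nat.
rewrite set_fsetK card_imfset //=.
by rewrite -card_finset.
Qed.

End LatticePoints.

(** * Counting lattice points by generating functions *)

Section SliceCounting.
Variables (n r t : nat).
Hypotheses (n_gt0 : (0 < n)%N).

Let below s := #|[pred f : {ffun 'I_n -> 'I_(r * t)} | (\sum_(i < n) f i < s)%N]|.

Let ones : fps rat := FPS (fun=> 1).

Let ones_inv : (1 - fpsX) * ones = 1.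
Proof.
by apply: fpsP => -[|s]; rewrite mulrBl mul1r fpsBE fpsXM fps1E /= ?subr0 ?subrr.
Qed.

(** The factor [fpsX * ones] is X / (1 - X), which sums the coefficients of index less than [s]. *)
Let below_gf : FPS (fun s => (below s)%:R) =
  fpsX * ones * (\sum_(i < r * t) fpsX ^+ i) ^+ n.
Proof.
have -> : (\sum_(i < r * t) fpsX ^+ i) ^+ n =
    \sum_(f : {ffun 'I_n -> 'I_(r * t)}) fpsX ^+ (\sum_(i < n) f i) :> fps rat.
  rewrite -[n in _ ^+ n]card_ord -prodr_const bigA_distr_bigA /=.
  by apply: eq_bigr => f _; rewrite prodrXr.
apply: fpsP => s; rewrite -mulrA mulr_sumr fpsXM /below.
case: s => [|s]; first by rewrite /= eq_card0 // => f; rewrite inE ltn0.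
rewrite fps_sumE -[LHS]/(#|[pred f : {ffun 'I_n -> 'I_(r * t)} | (\sum_(i < n) f i < s.+1)%N]|%:R).
rewrite -sum1_card natr_sum big_mkcond; apply: eq_bigr => f _.
by rewrite mulrC fpsXnM inE ltnS.
Qed.

(** The coefficients of X / (1 - X)^(n + 1). *)
Let rising : fps rat := FPS (fun s => 'C(s + n - 1, n)%:R).

Let rising_gf : (1 - fpsX) ^+ n * rising = fpsX * ones.
Proof.
rewrite /rising; case: n n_gt0 => // m _; elim: m => [|m IHm].
  rewrite expr1; apply: fpsP => s; rewrite mulrBl mul1r fpsBE !fpsXM.
  case: s => [|s] /=; rewrite ?subr0 //.
  by rewrite !addn1 !subn1 /= !bin1 -natrB ?subSnn // leqnSn.
rewrite exprSr -mulrA -IHm; congr (_ * _); apply: fpsP => s.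
rewrite mulrBl mul1r fpsBE !fpsXM; case: s => [|s] /=.
  by rewrite subr0 !bin_small // !add0n subn1.
have [-> [-> ->]] : (s.+1 + m.+2 - 1 = (s + m.+1).+1 /\ s + m.+2 - 1 = s + m.+1 /\
  s.+1 + m.+1 - 1 = s + m.+1)%N by lia.
by rewrite binS natrD addrC addKr.
Qed.

Lemma below_rising :
  FPS (fun s => (below s)%:R) = (1 - fpsX ^+ (r * t)) ^+ n * rising :> fps rat.
Proof.
have lreg : GRing.lreg ((1 - fpsX) ^+ n : fps rat).
  apply: fps_lreg1; rewrite fps0X fpsBE fps1E subr0 expr1n //.
apply: lreg; rewrite mulrCA rising_gf below_gf.
have -> : 1 - fpsX ^+ (r * t) = (1 - fpsX) * \sum_(i < r * t) fpsX ^+ i :> fps rat.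
  by rewrite -opprB subrX1 -mulNr opprB.
by rewrite exprMn; ring.
Qed.

Lemma card_slice_point k : (0 < t)%N -> (0 < k)%N ->
  #|[pred f : {ffun 'I_n -> 'I_(r * t)} | slice_point k f]|%:R = slice_gf r t n k.
Proof.
move=> t_gt0 k_gt0.
have sect j : (below (t * j))%:R = ((1 - fpsX ^+ r) ^+ n * neg_bin_series t 0 n) j.
  (* Taking every t-th coefficient replaces [fpsX ^+ (r * t)] by [fpsX ^+ r], so that [t] remains
     only in the binomial coefficients. *)
  have E m f : ((1 - fpsX ^+ (r * t)) ^+ m * f : fps rat) (t * j)%N =
       ((1 - fpsX ^+ r) ^+ m * FPS (fun j => f (t * j)%N) : fps rat) j.
    elim: m j f => [|m IHm] j' f; first by rewrite !expr0 !mul1r.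
    have -> : (1 - fpsX ^+ r) ^+ m.+1 * FPS (fun j => f (t * j)%N) =
        (1 - fpsX ^+ r) ^+ m *
        FPS (fun j => ((1 - fpsX ^+ (r * t)) * f : fps rat) (t * j)%N).
      rewrite exprSr -mulrA; congr (_ * _); apply: fpsP => i.
      rewrite -[RHS]/(((1 - fpsX ^+ (r * t)) * f : fps rat) (t * i)%N).
      rewrite !mulrBl !mul1r !fpsBE !fpsXnM /= [(r * t)%N]mulnC leq_pmul2l //.
      by case: ifP => // ri; rewrite mulnBr.
    by rewrite exprSr -mulrA IHm.
  rewrite -[LHS]/((FPS (fun s => (below s)%:R) : fps rat) (t * j)%N) below_rising E.
  rewrite (_ : FPS _ = neg_bin_series t 0 n) //.
  by apply: fpsP => i; rewrite /= addn0.
rewrite /slice_gf -mulrA mulrBl mul1r fpsBE fpsXM -(prednK k_gt0) -!sect prednK //.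
have -> : below (t * k) = (#|[pred f : {ffun 'I_n -> 'I_(r * t)} | slice_point k f]|
                           + below (t * k.-1))%N.
  rewrite /below -!sum1_card (bigID (fun f : {ffun 'I_n -> 'I_(r * t)} =>
    (t * k.-1 <= \sum_(i < n) f i)%N)) /=; congr addn; apply: eq_bigl => f; rewrite !inE.
    by rewrite /slice_point andbC.
  rewrite -ltnNge; apply/andP/idP => [[]//|lt]; split=> //.
  by apply: leq_trans lt _; rewrite leq_mul2l leq_pred orbT.
by rewrite natrD addrK.
Qed.

End SliceCounting.

(** Coordinates are at most [r * t - 1], so these slices have no points. The vanishing matters
    because a level series runs over all exponents of y. *)
Lemma slice_gf_large n r t k : (0 < n)%N -> (r * n < k)%N -> slice_gf r t n k = 0.
Proof.
move=> n_gt0 k_gt; case: (posnP t) => [->|t_gt0].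
  have B0 : neg_bin_series 0 0 n = 0.
    by apply: fpsP => j; rewrite /= mul0n addn0 add0n bin_small ?subn1 ?prednK // if_same.
  by rewrite /slice_gf B0 mulr0 -[LHS]/(fps_nth k 0) raddf0.
rewrite -card_slice_point //; last exact: leq_ltn_trans k_gt.
rewrite eq_card0 // => f; rewrite inE /slice_point; apply/negbTE/negP => /andP[lo _].
have : (\sum_(i < n) f i + n <= n * (r * t))%N.
  rewrite -[X in (_ + X <= _)%N]card_ord -[X in (_ + X)%N]muln1 -sum_nat_const -big_split.
  rewrite -[X in (_ <= X * _)%N]card_ord -sum_nat_const; apply: leq_sum => i _.
  by rewrite /= addn1 ltn_ord.
have : (t * (r * n) <= t * k.-1)%N by rewrite leq_mul2l -ltnS (ltn_predK k_gt) k_gt orbT.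
rewrite [(n * (r * t))%N]mulnC -mulnA mulnCA => h1 h2.
have := leq_trans h2 (leq_trans h1 lo).
by rewrite -[X in (_ <= X)%N]addn0 leq_add2l leqNgt n_gt0.
Qed.

(** * The Ehrhart polynomials of slices *)

Section SlicePolynomial.
Variables (n r k : nat).

Lemma bin_rising (N : nat) :
  'C(N + n - 1, n)%:R = (n`!%:R)^-1 * \prod_(m < n) (N%:R + m%:R) :> rat.
Proof.
have f0 : n`!%:R != 0 :> rat by rewrite pnatr_eq0 -lt0n fact_gt0.
apply: (mulIf f0); rewrite mulrAC mulVf // mul1r -natrM bin_ffact ffact_prod natr_prod.
rewrite (reindex_inj rev_ord_inj) /=; apply: eq_bigr => i _; rewrite -natrD.
by congr _%:R; have := ltn_ord i; lia.
Qed.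

Definition slice_poly : {poly rat} :=
  \sum_(i < k.+1) (((1 - fpsX) * (1 - fpsX ^+ r) ^+ n : fps rat) i / n`!%:R) *:
    \prod_(m < n) ((k - i)%:R *: 'X + m%:R%:P).

(** This covers [t = 0], where the Ehrhart series uses the value of the polynomial and not a lattice
    count. *)
Lemma slice_polyE t : slice_poly.[t%:R] = slice_gf r t n k.
Proof.
rewrite /slice_gf fpsME /slice_poly horner_sum; apply: eq_bigr => i _.
rewrite hornerZ horner_prod -mulrA; congr (_ * _).
rewrite /= addn0 bin_rising; congr (_ * _); apply: eq_bigr => m _.
by rewrite hornerD hornerZ hornerX hornerC natrM mulrC.
Qed.

End SlicePolynomial.

Lemma ehrhart_poly_unique (R : realType) n (X : set 'rV[R]_n) p :
  is_ehrhart_poly X p -> ehrhart_poly X = p.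
Proof.
move=> Xp; have : is_ehrhart_poly X (ehrhart_poly X).
  by apply: (@xgetPex _ 0 [set p | is_ehrhart_poly X p]%classic); exists p.
move: (ehrhart_poly X) => q Xq; apply/eqP; rewrite -subr_eq0; apply/negPn/negP => nz.
(* The roots start at 1 because lattice counts prescribe values at positive [t] only. *)
pose rs := [seq i.+1%:R : rat | i <- iota 0 (size (q - p))].
have := max_poly_roots (rs := rs) nz; rewrite size_map size_iota ltnn => /(_ _ _) roots.
apply: notF; apply: roots.
  apply/allP => x /mapP[i _ ->]; apply/rootP.
  by rewrite hornerD hornerN Xq ?Xp // subrr.
by rewrite map_inj_uniq ?iota_uniq // => i j /eqP; rewrite eqr_nat => /eqP[].
Qed.

Lemma ehrhart_star_slice (R : realType) n r k : (0 < n)%N -> (0 < k)%N ->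
  ehrhart_star (@slice R n r k) =
  (1 - fpsX) ^+ n.+1 * FPS (fun t => slice_gf r t n k).
Proof.
move=> n_gt0 k_gt0; rewrite /ehrhart_star (@ehrhart_poly_unique _ _ _ (slice_poly n r k)).
  by congr (_ * _); apply: fpsP => t; apply: slice_polyE.
by move=> t t_gt0; rewrite slice_polyE lattice_count_slice // card_slice_point.
Qed.

(** Coefficients of y are compared, with three boundary cases: [n = 0], where the slice series is 1
    at every level; [k = 0]; and [k > r * n], beyond the finite sum. *)
Lemma A_gf (R : realType) r n :
  \sum_(k < (r * n).+1) fpsC (A_coef R r n k) * fpsX ^+ k =
  (1 - fpsC fpsX) ^+ n.+1 * level_series (fun t => slice_gf r t n).
Proof.
have ones_inv : (1 - fpsX) * FPS (fun=> 1) = 1 :> fps rat.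
  by apply: fpsP => -[|s]; rewrite mulrBl mul1r fpsBE fpsXM fps1E /= ?subr0 ?subrr.
apply: fpsP => k; rewrite -(rmorph1 (@fpsC _)) -rmorphB -rmorphXn fpsCM fps_sumE.
rewrite -[level_series _ k]/(FPS (fun t => slice_gf r t n k)).
transitivity (if (k <= r * n)%N then A_coef R r n k else 0).
  under eq_bigr => j _ do rewrite fpsCM fpsXnE mulr_natr.
  case: leqP => kn.
    rewrite (bigD1 (Ordinal (kn : (k < (r * n).+1)%N))) //= eqxx mulr1n big1 ?addr0 // => j.
    by rewrite -val_eqE /= eq_sym => /negPf ->.
  rewrite big1 // => j _; rewrite gtn_eqF //.
  by rewrite (leq_trans _ kn) // ltn_ord.
case: (posnP n) => [->|n_gt0].
  have slice0 t : slice_gf r t 0 = 1.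
    rewrite /slice_gf expr0 mulr1 -[RHS]ones_inv; congr (_ * _).
    by apply: fpsP => j; rewrite /= bin0.
  rewrite muln0 leqn0 expr1 /A_coef; case: (posnP k) => [->|k_gt0].
    rewrite -[LHS]ones_inv; congr (_ * _); apply: fpsP => t.
    by rewrite -[RHS]/(slice_gf r t 0 0%N) slice0.
  rewrite (_ : FPS _ = 0) ?mulr0 //.
  apply: fpsP => t; rewrite -[LHS]/(slice_gf r t 0 k) slice0 fps1E gtn_eqF //.
  by rewrite /= if_same.
case: (posnP k) => [->|k_gt0].
  rewrite leq0n /A_coef eqxx gtn_eqF // (_ : FPS _ = 0) ?mulr0 //.
  apply: fpsP => t; rewrite -[LHS]/(slice_gf r t n 0%N) /slice_gf fps0M.
  have -> : neg_bin_series t 0 n 0%N = 0 by rewrite /= muln0 bin_small //; lia.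
  by rewrite mulr0 /= if_same.
case: leqP => kn; first by rewrite /A_coef gtn_eqF // ehrhart_star_slice.
have -> : FPS (fun t => slice_gf r t n k) = 0.
  by apply: fpsP => t; rewrite -[LHS]/(slice_gf r t n k) slice_gf_large //= if_same.
by rewrite mulr0.
Qed.

(** * Assembling the levels *)

Section LevelSeries.
Implicit Types phi psi : nat -> fps rat.

Lemma level_series_sum (I : Type) (s : seq I) (F : I -> nat -> fps rat) :
  level_series (fun t => \sum_(i <- s) F i t) = \sum_(i <- s) level_series (F i).
Proof.
apply: fpsP => k; rewrite fps_sumE; apply: fpsP => t; rewrite fps_sumE /=.
by rewrite fps_sumE.
Qed.

Lemma level_seriesMn phi m : level_series (fun t => phi t *+ m) = level_series phi *+ m.
Proof. by apply: fpsP => k; apply: fpsP => t; rewrite /= !fpsMnE. Qed.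

Lemma level_seriesXn phi m :
  level_series (fun t => fpsX ^+ m * phi t) = fpsX ^+ m * level_series phi.
Proof.
apply: fpsP => k; apply: fpsP => t; rewrite fpsXnM.
rewrite -[LHS]/((fpsX ^+ m * phi t) k) fpsXnM.
by case: leqP => //= _; rewrite if_same.
Qed.

End LevelSeries.

Lemma ratC_natr (m : nat) : ratC m%:R = m%:R.
Proof. by rewrite /ratC !rmorph_nat. Qed.

Lemma ratCM a b : ratC (a * b) = ratC a * ratC b.
Proof. by rewrite /ratC !rmorphM. Qed.

Lemma fps_exp_monomial (g : fps_yz) m :
  fps_exp (fpsC g * fpsX) m = ratC (m`!%:R)^-1 * g ^+ m.
Proof.
rewrite /= (bigD1 ord_max) //= big1 ?addr0 => [|k km].
  by rewrite exprMn -rmorphXn fpsCM fpsXnE eqxx mulr1.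
rewrite exprMn -rmorphXn fpsCM fpsXnE (_ : (m == k)%N = false) ?mulr0 //.
by apply/negbTE; apply: contraNneq km => km; apply/eqP/val_inj.
Qed.

Theorem theorem6p1 (R : realType) (r : nat) (hr : (1 <= r)%N) :
  C_series r = fps_exp ((1 - varz) * vary ^+ r * varx) * A_series R r.
Proof.
pose z : fps_yz := fpsC fpsX; pose y : fps_yz := fpsX.
have -> : (1 - varz) * vary ^+ r * varx = fpsC ((1 - z) * y ^+ r) * fpsX.
  by rewrite rmorphM rmorphB rmorph1 rmorphXn.
apply: fpsP => n; rewrite fpsME -[LHS]/(ratC _ * _) C_gf //.
have -> : level_series (fun t => exc_gf r t n) =
    \sum_(m < n.+1) (y ^+ (r * m) * level_series (fun t => slice_gf r t (n - m))) *+ 'C(n, m).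
  have -> : (fun t => exc_gf r t n) = fun t =>
      \sum_(m < n.+1) (fpsX ^+ (r * m) * slice_gf r t (n - m)) *+ 'C(n, m).
    apply/funext => t; rewrite exc_gf_slices //.
    by apply: eq_bigr => m _; rewrite exprM.
  rewrite (level_series_sum _ (fun (m : 'I_n.+1) t =>
    (fpsX ^+ (r * m) * slice_gf r t (n - m)) *+ 'C(n, m))).
  by apply: eq_bigr => m _; rewrite level_seriesMn level_seriesXn.
rewrite mulr_sumr mulr_sumr; apply: eq_bigr => m _.
rewrite fps_exp_monomial -[A_series R r _]/(ratC _ * _) A_gf.
have mn : (m <= n)%N by rewrite -ltnS.
(* The power [n.+1] splits as [m + (n - m).+1]: the first part belongs to the exponential, the
   second to the slices in dimension [n - m]. *)
have -> : ratC (n`!%:R)^-1 * ((1 - fpsC fpsX) ^+ n.+1 *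
     (y ^+ (r * m) * level_series (fun t => slice_gf r t (n - m)) *+ 'C(n, m))) =
  ratC ((n`!%:R)^-1 * 'C(n, m)%:R) * ((1 - z) ^+ (m + (n - m).+1) *
     (y ^+ (r * m) * level_series (fun t => slice_gf r t (n - m)))).
  by rewrite ratCM ratC_natr addnS subnKC // -mulr_natl; ring.
have -> : (n`!%:R)^-1 * 'C(n, m)%:R = (m`!%:R)^-1 * ((n - m)`!%:R)^-1 :> rat.
  have nz k : k`!%:R != 0 :> rat by rewrite pnatr_eq0 -lt0n fact_gt0.
  rewrite -(bin_fact mn) !natrM !invfM; field.
  by rewrite !nz pnatr_eq0 -lt0n bin_gt0.
rewrite ratCM exprD exprMn -exprM; ring.
Qed.
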